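(* Let $(\mathcal{C},K)$ be an abelian braided Grothendieck–Verdier category with bilinear tensor product bifunctor, dualizing functor $D$ and braiding $c$, and let $(A,\mu_A,\iota_A)$ be a commutative algebra in $\mathcal{C}$. Then the category $\mathcal{C}_A$ of left $A$-modules in $\mathcal{C}$ is an abelian Grothendieck–Verdier category with dualizing object $(DA,\mu_{DA})$, where $\mu_{DA}:A\otimes DA\to DA$ is the unique morphism such that $$e_A\circ(\mu_{DA}\otimes\mathrm{id}_A)=e_A\circ(\mathrm{id}_{DA}\otimes\mu_A)\circ(c_{A,DA}\otimes\mathrm{id}_A).$$
   Context: Associativity and unit isomorphisms are suppressed. An object $K$ of a monoidal category $\mathcal{C}$ is dualizing if for every $X\in\mathcal{C}$ the functor $\mathrm{Hom}_{\mathcal{C}}(-\otimes X,K)$ is representable and the resulting contravariant functor $D:\mathcal{C}\to\mathcal{C}$ is an anti-equivalence. Representability means that there are an object $DX$ and a morphism $e_X:DX\otimes X\to K$ such that for every morphism $f:Y\otimes X\to K$ there is a unique $\varphi:Y\to DX$ with $e_X\circ(\varphi\otimes\mathrm{id}_X)=f$. On a morphism $f:X\to Y$, $Df:DY\to DX$ is the unique morphism with $e_X\circ(Df\otimes\mathrm{id}_X)=e_Y\circ(\mathrm{id}_{DY}\otimes f)$. A (braided) Grothendieck–Verdier category is a (braided) monoidal category equipped with a dualizing object; $D$ is its dualizing functor. Here ''abelian'' means $\mathbb{K}$-linear abelian for a field $\mathbb{K}$, with $\mathbb{K}$-bilinear tensor product (the tensor product is then automatically right exact in each variable). An algebra $(A,\mu_A,\iota_A)$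 is commutative if $\mu_A\circ c_{A,A}=\mu_A$. $\mathcal{C}_A$ is the category of left $A$-modules $(M,\mu_M)$. It is monoidal with unit $A$: $M\otimes_A N$ is the coequalizer, with projection $\pi_{M,N}:M\otimes N\to M\otimes_A N$, of the two morphisms $\mu_M\otimes\mathrm{id}_N$ and $(\mathrm{id}_M\otimes\mu_N)\circ(c_{A,M}\otimes\mathrm{id}_N)$ from $A\otimes M\otimes N$ to $M\otimes N$, with $A$-action determined by $\mu_{M\otimes_A N}\circ(\mathrm{id}_A\otimes\pi_{M,N})=\pi_{M,N}\circ(\mu_M\otimes\mathrm{id}_N)$. *)

(* Defs.v *)
From HB Require Import structures.
From mathcomp Require Import all_boot all_algebra.

Set Implicit Arguments.
Unset Strict Implicit.
Unset Printing Implicit Defensive.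

Import GRing.Theory.
Local Open Scope ring_scope.

Declare Scope cat_scope.
Delimit Scope cat_scope with cat.
Local Open Scope cat_scope.

Record lincat (k : fieldType) := LinCat {
  Ob :> Type;
  mor : Ob -> Ob -> lmodType k;
  idm : forall X, mor X X;
  compm : forall X Y Z, mor Y Z -> mor X Y -> mor X Z;
  comp_idl : forall X Y (f : mor X Y), compm (idm Y) f = f;
  comp_idr : forall X Y (f : mor X Y), compm f (idm X) = f;
  compmA : forall W X Y Z (h : mor Y Z) (g : mor X Y) (f : mor W X),
    compm h (compm g f) = compm (compm h g) f;
  comp_linl : forall X Y Z (a : k) (g g' : mor Y Z) (f : mor X Y),
    compm (a *: g + g') f = a *: compm g f + compm g' f;
  comp_linr : forall X Y Z (a : k) (g : mor Y Z) (f f' : mor X Y),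
    compm g (a *: f + f') = a *: compm g f + compm g f'
}.

Arguments mor {k l} X Y.
Arguments idm {k l} X.
Arguments compm {k l X Y Z} g f.

Notation "g ∘ f" := (compm g f) (at level 40, left associativity) : cat_scope.

Definition inverse_of (k : fieldType) (C : lincat k) (X Y : C)
    (f : mor X Y) (g : mor Y X) : Prop :=
  g ∘ f = idm X /\ f ∘ g = idm Y.

Definition is_iso (k : fieldType) (C : lincat k) (X Y : C) (f : mor X Y) :
    Prop :=
  exists g : mor Y X, inverse_of f g.

Definition mono (k : fieldType) (C : lincat k) (X Y : C) (f : mor X Y) : Prop :=
  forall (Z : C) (g h : mor Z X), f ∘ g = f ∘ h -> g = h.

Definition epi (k : fieldType) (C : lincat k) (X Y : C) (f : mor X Y) : Prop :=
  forall (Z : C) (g h : mor Y Z), g ∘ f = h ∘ f -> g = h.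

Definition is_zero_object (k : fieldType) (C : lincat k) (Z : C) : Prop :=
  forall X : C, (forall f g : mor X Z, f = g) /\ (forall f g : mor Z X, f = g).

Definition has_biproduct (k : fieldType) (C : lincat k) (X Y : C) : Prop :=
  exists (P : C) (i : mor X P) (j : mor Y P) (p : mor P X) (q : mor P Y),
    [/\ p ∘ i = idm X, q ∘ j = idm Y, p ∘ j = 0, q ∘ i = 0
      & i ∘ p + j ∘ q = idm P].

Definition is_kernel (k : fieldType) (C : lincat k) (N X Y : C)
    (f : mor X Y) (i : mor N X) : Prop :=
  f ∘ i = 0 /\
  forall (Z : C) (g : mor Z X), f ∘ g = 0 -> exists! h : mor Z N, i ∘ h = g.

Definition is_cokernel (k : fieldType) (C : lincat k) (X Y Q : C)
    (f : mor X Y) (p : mor Y Q) : Prop :=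
  p ∘ f = 0 /\
  forall (Z : C) (g : mor Y Z), g ∘ f = 0 -> exists! h : mor Q Z, h ∘ p = g.

Definition is_coequalizer (k : fieldType) (C : lincat k) (X Y Q : C)
    (f g : mor X Y) (p : mor Y Q) : Prop :=
  p ∘ f = p ∘ g /\
  forall (Z : C) (h : mor Y Z), h ∘ f = h ∘ g -> exists! t : mor Q Z, t ∘ p = h.

Record is_abelian (k : fieldType) (C : lincat k) : Prop := IsAbelian {
  abelian_zero : exists Z : C, is_zero_object Z;
  abelian_biproduct : forall X Y : C, has_biproduct X Y;
  abelian_kernel : forall (X Y : C) (f : mor X Y),
    exists (N : C) (i : mor N X), is_kernel f i;
  abelian_cokernel : forall (X Y : C) (f : mor X Y),
    exists (Q : C) (p : mor Y Q), is_cokernel f p;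
  abelian_mono : forall (X Y : C) (f : mor X Y), mono f ->
    exists (Z : C) (g : mor Y Z), is_kernel g f;
  abelian_epi : forall (X Y : C) (f : mor X Y), epi f ->
    exists (Z : C) (g : mor Z X), is_cokernel g f
}.

Record functor (k : fieldType) (C D : lincat k) := Functor {
  fob :> C -> D;
  fmap : forall X Y : C, mor X Y -> mor (fob X) (fob Y);
  fmap_id : forall X : C, fmap (idm X) = idm (fob X);
  fmap_comp : forall (X Y Z : C) (g : mor Y Z) (f : mor X Y),
    fmap (g ∘ f) = fmap g ∘ fmap f
}.

Arguments fmap {k C D} f {X Y} _ : rename.

Definition id_functor (k : fieldType) (C : lincat k) : functor C C :=
  @Functor k C C (fun X => X) (fun _ _ f => f) (fun _ => erefl)
    (fun _ _ _ _ _ => erefl).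

Lemma comp_functor_id (k : fieldType) (C D E : lincat k)
    (G : functor D E) (F : functor C D) (X : C) :
  fmap G (fmap F (idm X)) = idm (G (F X)).
Proof. by rewrite !fmap_id. Qed.

Lemma comp_functor_comp (k : fieldType) (C D E : lincat k)
    (G : functor D E) (F : functor C D) (X Y Z : C)
    (g : mor Y Z) (f : mor X Y) :
  fmap G (fmap F (g ∘ f)) = fmap G (fmap F g) ∘ fmap G (fmap F f).
Proof. by rewrite !fmap_comp. Qed.

Definition comp_functor (k : fieldType) (C D E : lincat k)
    (G : functor D E) (F : functor C D) : functor C E :=
  @Functor k C E (fun X => G (F X)) (fun _ _ f => fmap G (fmap F f))
    (comp_functor_id G F) (@comp_functor_comp k C D E G F).

Definition naturally_isomorphic (k : fieldType) (C D : lincat k)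
    (F G : functor C D) : Prop :=
  exists t : forall X : C, mor (F X) (G X),
    (forall X, is_iso (t X)) /\
    (forall (X Y : C) (f : mor X Y), t Y ∘ fmap F f = fmap G f ∘ t X).

Definition is_equivalence (k : fieldType) (C D : lincat k) (F : functor C D) :
    Prop :=
  exists G : functor D C,
    naturally_isomorphic (comp_functor G F) (id_functor C) /\
    naturally_isomorphic (comp_functor F G) (id_functor D).

Definition opposite (k : fieldType) (C : lincat k) : lincat k :=
  @LinCat k (Ob C) (fun X Y => mor Y X) (fun X => idm X)
    (fun _ _ _ g f => f ∘ g)
    (fun _ _ f => comp_idr f) (fun _ _ f => comp_idl f)
    (fun _ _ _ _ h g f => esym (compmA f g h))
    (fun _ _ _ a g g' f => comp_linr a f g g')
    (fun _ _ _ a g f f' => comp_linl a f f' g).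

(* The unit object is a parameter so that a monoidal structure on a category of
   modules can be required to have the regular module as its unit on the
   nose. *)
Record monoidal (k : fieldType) (C : lincat k) (I : C) := Monoidal {
  tens : C -> C -> C;
  tensm : forall X X' Y Y' : C,
    mor X X' -> mor Y Y' -> mor (tens X Y) (tens X' Y');
  assoc : forall X Y Z : C, mor (tens (tens X Y) Z) (tens X (tens Y Z));
  associ : forall X Y Z : C, mor (tens X (tens Y Z)) (tens (tens X Y) Z);
  lunit : forall X : C, mor (tens I X) X;
  runit : forall X : C, mor (tens X I) X;
  tensm_id : forall X Y : C, tensm (idm X) (idm Y) = idm (tens X Y);
  tensm_comp : forall (X X' X'' Y Y' Y'' : C)
      (f' : mor X' X'') (f : mor X X') (g' : mor Y' Y'') (g : mor Y Y'),
    tensm (f' ∘ f) (g' ∘ g) = tensm f' g' ∘ tensm f g;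
  tensm_linl : forall (X X' Y Y' : C) (a : k) (f f' : mor X X') (g : mor Y Y'),
    tensm (a *: f + f') g = a *: tensm f g + tensm f' g;
  tensm_linr : forall (X X' Y Y' : C) (a : k) (f : mor X X') (g g' : mor Y Y'),
    tensm f (a *: g + g') = a *: tensm f g + tensm f g';
  assoc_inv : forall X Y Z, inverse_of (assoc X Y Z) (associ X Y Z);
  lunit_iso : forall X, is_iso (lunit X);
  runit_iso : forall X, is_iso (runit X);
  assoc_nat : forall (X X' Y Y' Z Z' : C)
      (f : mor X X') (g : mor Y Y') (h : mor Z Z'),
    assoc X' Y' Z' ∘ tensm (tensm f g) h = tensm f (tensm g h) ∘ assoc X Y Z;
  lunit_nat : forall (X Y : C) (f : mor X Y),
    lunit Y ∘ tensm (idm I) f = f ∘ lunit X;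
  runit_nat : forall (X Y : C) (f : mor X Y),
    runit Y ∘ tensm f (idm I) = f ∘ runit X;
  pentagon : forall W X Y Z : C,
    assoc W X (tens Y Z) ∘ assoc (tens W X) Y Z =
    tensm (idm W) (assoc X Y Z) ∘ assoc W (tens X Y) Z ∘
      tensm (assoc W X Y) (idm Z);
  triangle : forall X Y : C,
    tensm (idm X) (lunit Y) ∘ assoc X I Y = tensm (runit X) (idm Y)
}.

Arguments tens {k C I} m X Y : rename.
Arguments tensm {k C I} m {X X' Y Y'} f g : rename.
Arguments assoc {k C I} m X Y Z : rename.
Arguments associ {k C I} m X Y Z : rename.
Arguments lunit {k C I} m X : rename.
Arguments runit {k C I} m X : rename.

Notation "X ⊗[ M ] Y" := (tens M X Y)
  (at level 39, left associativity, format "X  ⊗[ M ]  Y") : cat_scope.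
Notation "f ⊠[ M ] g" := (tensm M f g)
  (at level 39, left associativity, format "f  ⊠[ M ]  g") : cat_scope.

Record braiding (k : fieldType) (C : lincat k) (I : C) (M : monoidal I) :=
  Braiding {
  br :> forall X Y : C, mor (X ⊗[M] Y) (Y ⊗[M] X);
  br_iso : forall X Y, is_iso (br X Y);
  br_nat : forall (X X' Y Y' : C) (f : mor X X') (g : mor Y Y'),
    br X' Y' ∘ (f ⊠[M] g) = (g ⊠[M] f) ∘ br X Y;
  hexagon1 : forall X Y Z : C,
    assoc M Y Z X ∘ br X (Y ⊗[M] Z) ∘ assoc M X Y Z =
    (idm Y ⊠[M] br X Z) ∘ assoc M Y X Z ∘ (br X Y ⊠[M] idm Z);
  hexagon2 : forall X Y Z : C,
    associ M Z X Y ∘ br (X ⊗[M] Y) Z ∘ associ M X Y Z =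
    (br X Z ⊠[M] idm Y) ∘ associ M X Z Y ∘ (idm X ⊠[M] br Y Z)
}.

(* A choice, for every [X], of an object representing [Hom(- ⊗ X, K)]. *)
Record dual_data (k : fieldType) (C : lincat k) (I : C) (M : monoidal I)
    (K : C) := DualData {
  dual_ob : C -> C;
  ev : forall X : C, mor (dual_ob X ⊗[M] X) K;
  ev_universal : forall (X Y : C) (f : mor (Y ⊗[M] X) K),
    exists! phi : mor Y (dual_ob X), ev X ∘ (phi ⊠[M] idm X) = f
}.

Arguments dual_ob {k C I M K} d X : rename.
Arguments ev {k C I M K} d X : rename.

Lemma transpose_ex (k : fieldType) (C : lincat k) (I : C) (M : monoidal I)
    (K : C) (D : dual_data M K) (X Y : C) (f : mor (Y ⊗[M] X) K) :
  exists phi : mor Y (dual_ob D X), ev D X ∘ (phi ⊠[M] idm X) == f.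
Proof. by have [phi [/eqP e _]] := ev_universal D f; exists phi. Qed.

Definition transpose (k : fieldType) (C : lincat k) (I : C) (M : monoidal I)
    (K : C) (D : dual_data M K) (X Y : C) (f : mor (Y ⊗[M] X) K) :
    mor Y (dual_ob D X) :=
  xchoose (transpose_ex D f).

Lemma transposeP (k : fieldType) (C : lincat k) (I : C) (M : monoidal I)
    (K : C) (D : dual_data M K) (X Y : C) (f : mor (Y ⊗[M] X) K) :
  ev D X ∘ (transpose D f ⊠[M] idm X) = f.
Proof. exact/eqP/(xchooseP (transpose_ex D f)). Qed.

Lemma transpose_uniq (k : fieldType) (C : lincat k) (I : C) (M : monoidal I)
    (K : C) (D : dual_data M K) (X Y : C) (f : mor (Y ⊗[M] X) K)
    (phi : mor Y (dual_ob D X)) :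
  ev D X ∘ (phi ⊠[M] idm X) = f -> transpose D f = phi.
Proof.
move=> e; have [psi [_ uniq_psi]] := ev_universal D f.
by rewrite -(uniq_psi _ (transposeP D f)) (uniq_psi _ e).
Qed.

Definition dual_map (k : fieldType) (C : lincat k) (I : C) (M : monoidal I)
    (K : C) (D : dual_data M K) (X Y : C) (f : mor X Y) :
    mor (dual_ob D Y) (dual_ob D X) :=
  transpose D (ev D Y ∘ (idm (dual_ob D Y) ⊠[M] f)).

Lemma dual_map_id (k : fieldType) (C : lincat k) (I : C) (M : monoidal I)
    (K : C) (D : dual_data M K) (X : C) :
  dual_map D (idm X) = idm (dual_ob D X).
Proof. exact: transpose_uniq. Qed.

Lemma dual_map_comp (k : fieldType) (C : lincat k) (I : C) (M : monoidal I)
    (K : C) (D : dual_data M K) (X Y Z : C) (f : mor X Y) (g : mor Y Z) :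
  dual_map D (g ∘ f) = dual_map D f ∘ dual_map D g.
Proof.
apply: transpose_uniq.
have -> : ((dual_map D f ∘ dual_map D g) ⊠[M] idm X) =
    (dual_map D f ⊠[M] idm X) ∘ (dual_map D g ⊠[M] idm X).
  by rewrite -tensm_comp comp_idl.
rewrite compmA transposeP -compmA -tensm_comp comp_idl comp_idr.
rewrite -[dual_map D g]comp_idl -[f in _ ⊠[M] f]comp_idr.
have -> : ((idm (dual_ob D Y) ∘ dual_map D g) ⊠[M] (f ∘ idm X)) =
    (dual_map D g ⊠[M] idm Y) ∘ (idm (dual_ob D Z) ⊠[M] f).
  by rewrite -tensm_comp !comp_idl !comp_idr.
by rewrite compmA transposeP -compmA -tensm_comp comp_idl.
Qed.

Definition dualizing_functor (k : fieldType) (C : lincat k) (I : C)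
    (M : monoidal I) (K : C) (D : dual_data M K) : functor (opposite C) C :=
  @Functor k (opposite C) C (dual_ob D) (fun X Y f => dual_map D f)
    (dual_map_id D) (fun X Y Z g f => dual_map_comp D g f).

Record dualizing (k : fieldType) (C : lincat k) (I : C) (M : monoidal I)
    (K : C) := Dualizing {
  dualizing_data :> dual_data M K;
  dualizing_equiv : is_equivalence (dualizing_functor dualizing_data)
}.

Definition is_dualizing (k : fieldType) (C : lincat k) (I : C)
    (M : monoidal I) (K : C) : Prop :=
  inhabited (dualizing M K).

Record algebra (k : fieldType) (C : lincat k) (I : C) (M : monoidal I) :=
  Algebra {
  acar :> C;
  amul : mor (acar ⊗[M] acar) acar;
  aone : mor I acar;
  amulA : amul ∘ (amul ⊠[M] idm acar) =
    amul ∘ (idm acar ⊠[M] amul) ∘ assoc M acar acar acar;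
  amul1l : amul ∘ (aone ⊠[M] idm acar) = lunit M acar;
  amul1r : amul ∘ (idm acar ⊠[M] aone) = runit M acar
}.

Definition commutative_algebra (k : fieldType) (C : lincat k) (I : C)
    (M : monoidal I) (c : braiding M) (A : algebra M) : Prop :=
  amul A ∘ c A A = amul A.

Definition is_action (k : fieldType) (C : lincat k) (I : C) (M : monoidal I)
    (A : algebra M) (X : C) (lact : mor (A ⊗[M] X) X) : Prop :=
  lact ∘ (amul A ⊠[M] idm X) =
    lact ∘ (idm (acar A) ⊠[M] lact) ∘ assoc M A A X /\
  lact ∘ (aone A ⊠[M] idm X) = lunit M X.

Record lmodule (k : fieldType) (C : lincat k) (I : C) (M : monoidal I)
    (A : algebra M) := LModule {
  mcar :> C;
  lact : mor (A ⊗[M] mcar) mcar;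
  actP : is_action lact
}.

Arguments lact {k C I M A} l : rename.

Definition is_mod_hom (k : fieldType) (C : lincat k) (I : C) (M : monoidal I)
    (A : algebra M) (X Y : lmodule A) : pred (mor (mcar X) (mcar Y)) :=
  fun f => f ∘ lact X == lact Y ∘ (idm (acar A) ⊠[M] f).

Lemma is_mod_hom_closed (k : fieldType) (C : lincat k) (I : C)
    (M : monoidal I) (A : algebra M) (X Y : lmodule A) :
  submod_closed (@is_mod_hom k C I M A X Y).
Proof.
split=> [|a f g]; last first.
  rewrite !unfold_in => /eqP ef /eqP eg.
  by rewrite comp_linl tensm_linr comp_linr ef eg.
have e0 (V : lmodType k) (v : V) : 0 = -1 *: v + v by rewrite scaleN1r addNr.
rewrite unfold_in /is_mod_hom; apply/eqP.
rewrite [in LHS](e0 _ 0) [in RHS](e0 _ 0).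
by rewrite comp_linl tensm_linr comp_linr -!e0.
Qed.

HB.instance Definition _ (k : fieldType) (C : lincat k) (I : C)
    (M : monoidal I) (A : algebra M) (X Y : lmodule A) :=
  GRing.isSubmodClosed.Build k (mor (mcar X) (mcar Y))
    (@is_mod_hom k C I M A X Y)
    (GRing.submod_closed_semi (@is_mod_hom_closed k C I M A X Y)).

Record mod_hom (k : fieldType) (C : lincat k) (I : C) (M : monoidal I)
    (A : algebra M) (X Y : lmodule A) := ModHom {
  mod_hom_val : mor (mcar X) (mcar Y);
  mod_homP : is_mod_hom mod_hom_val
}.

HB.instance Definition _ (k : fieldType) (C : lincat k) (I : C)
    (M : monoidal I) (A : algebra M) (X Y : lmodule A) :=
  [isSub for @mod_hom_val k C I M A X Y].
HB.instance Definition _ (k : fieldType) (C : lincat k) (I : C)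
    (M : monoidal I) (A : algebra M) (X Y : lmodule A) :=
  [Choice of mod_hom X Y by <:].
HB.instance Definition _ (k : fieldType) (C : lincat k) (I : C)
    (M : monoidal I) (A : algebra M) (X Y : lmodule A) :=
  [SubChoice_isSubLmodule of mod_hom X Y by <:].

Definition mod_idm (k : fieldType) (C : lincat k) (I : C) (M : monoidal I)
    (A : algebra M) (X : lmodule A) : mod_hom X X.
Proof.
by exists (idm (mcar X)); rewrite /is_mod_hom comp_idl tensm_id comp_idr.
Defined.

Definition mod_comp (k : fieldType) (C : lincat k) (I : C) (M : monoidal I)
    (A : algebra M) (X Y Z : lmodule A) (g : mod_hom Y Z) (f : mod_hom X Y) :
    mod_hom X Z.
Proof.
exists (mod_hom_val g ∘ mod_hom_val f).
rewrite /is_mod_hom -[idm (acar A)]comp_idl tensm_comp compmA.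
by rewrite -(eqP (mod_homP g)) -!compmA (eqP (mod_homP f)).
Defined.

Definition mod_cat (k : fieldType) (C : lincat k) (I : C) (M : monoidal I)
    (A : algebra M) : lincat k.
Proof.
apply: (@LinCat k (lmodule A) (fun X Y => mod_hom X Y)
  (@mod_idm k C I M A) (@mod_comp k C I M A)).
- by move=> X Y f; apply/val_inj/comp_idl.
- by move=> X Y f; apply/val_inj/comp_idr.
- by move=> W X Y Z h g f; apply/val_inj/compmA.
- by move=> X Y Z a g g' f; apply/val_inj/comp_linl.
- by move=> X Y Z a g f f'; apply/val_inj/comp_linr.
Defined.

Lemma regular_is_action (k : fieldType) (C : lincat k) (I : C)
    (M : monoidal I) (A : algebra M) : is_action (amul A).
Proof. by split; [exact: amulA | exact: amul1l]. Qed.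

Definition regular_mod (k : fieldType) (C : lincat k) (I : C)
    (M : monoidal I) (A : algebra M) : mod_cat A :=
  LModule (regular_is_action A).

(* [T] is the monoidal structure of [mod_cat A] with [X ⊗[T] Y] the coequalizer
   [X ⊗_A Y] and all its structure morphisms induced by those of [C] along
   the projections [pi].  The right action of [A] on [X] that is used in the
   definition of [X ⊗_A A] is [lact X] after the inverse of [c A X]; hence the
   form of [relative_runit]. *)
Record is_relative_tensor (k : fieldType) (C : lincat k) (I : C)
    (M : monoidal I) (c : braiding M) (A : algebra M)
    (T : monoidal (regular_mod A))
    (pi : forall X Y : lmodule A, mor (mcar X ⊗[M] mcar Y) (mcar (X ⊗[T] Y))) :
    Prop := IsRelativeTensor {
  relative_coeq : forall X Y : lmodule A,
    is_coequalizer
      (lact X ⊠[M] idm (mcar Y))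
      ((idm (mcar X) ⊠[M] lact Y) ∘ assoc M X A Y ∘ (c A X ⊠[M] idm (mcar Y)))
      (pi X Y);
  relative_act : forall X Y : lmodule A,
    lact (X ⊗[T] Y) ∘ (idm (acar A) ⊠[M] pi X Y) ∘ assoc M A X Y =
    pi X Y ∘ (lact X ⊠[M] idm (mcar Y));
  relative_tensm : forall (X X' Y Y' : lmodule A)
      (f : mod_hom X X') (g : mod_hom Y Y'),
    mod_hom_val (f ⊠[T] g) ∘ pi X Y =
    pi X' Y' ∘ (mod_hom_val f ⊠[M] mod_hom_val g);
  relative_assoc : forall X Y Z : lmodule A,
    mod_hom_val (assoc T X Y Z) ∘ pi (X ⊗[T] Y) Z ∘
      (pi X Y ⊠[M] idm (mcar Z)) =
    pi X (Y ⊗[T] Z) ∘ (idm (mcar X) ⊠[M] pi Y Z) ∘ assoc M X Y Z;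
  relative_lunit : forall X : lmodule A,
    mod_hom_val (lunit T X) ∘ pi (regular_mod A) X = lact X;
  relative_runit : forall X : lmodule A,
    mod_hom_val (runit T X) ∘ pi X (regular_mod A) ∘ c A X = lact X
}.

Definition relative_monoidal (k : fieldType) (C : lincat k) (I : C)
    (M : monoidal I) (c : braiding M) (A : algebra M)
    (T : monoidal (regular_mod A)) : Prop :=
  exists pi : forall X Y : lmodule A,
      mor (mcar X ⊗[M] mcar Y) (mcar (X ⊗[T] Y)),
    is_relative_tensor c pi.

Definition is_dual_action (k : fieldType) (C : lincat k) (I : C)
    (M : monoidal I) (c : braiding M) (K : C) (D : dual_data M K)
    (A : algebra M) (mu : mor (A ⊗[M] dual_ob D A) (dual_ob D A)) : Prop :=
  ev D A ∘ (mu ⊠[M] idm (acar A)) =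
  ev D A ∘ (idm (dual_ob D A) ⊠[M] amul A) ∘ assoc M (dual_ob D A) A A ∘
    (c A (dual_ob D A) ⊠[M] idm (acar A)).

(* Main.v *)
Require Import Defs.
From mathcomp Require Import all_boot all_algebra.
From Stdlib Require Import IndefiniteDescription.

Set Implicit Arguments.
Unset Strict Implicit.
Unset Printing Implicit Defensive.

Import GRing.Theory.
Local Open Scope ring_scope.
Local Open Scope cat_scope.

(** Write [XY] for tensor products in [C].

    Why [C_A] is monoidal.  A Grothendieck-Verdier category is closed: every
    object is isomorphic to some [DV], and [Hom(YZ, DV)], [Hom(YZV, K)] and
    [Hom(Y, D(ZV))] agree.  Hence tensoring with a fixed object, on either side,
    has a right adjoint and preserves coequalizers ([tensl_coequalizer],
    [tensr_coequalizer]).  With [A] as the fixed object this makes cokernels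
    of module morphisms into modules, so that [C_A] inherits abelianness from [C]
    ([mod_cat_abelian]).  On [XY] there are two actions of [A], one on [X] and
    one that crosses [X] and acts on [Y]; they commute up to the braiding of [A]
    with itself, so by commutativity of [A] their coequalizer carries an action
    ([coequalizer_action]).  The projection onto it is the universal bilinear
    map, and both threefold products over [A] are universal trilinear maps
    ([tril_factor], [trir_factor]).  This gives the associator together with its
    inverse; every coherence law of [C_A] then follows from the one in [C],
    since iterated projections are epimorphisms.

    Why [DA] is dualizing.  On [DX] there is exactly one morphism
    [A(DX) → DX] that makes the evaluation [(DX)X → K] balanced, and it is an
    action ([dual_act_is_action]).  For [X = A] this is the action of the
    theorem, and [DA] is then the cofree module on [K]: module morphisms
    [Y → DA] are the morphisms [Y → K] of [C] ([cofree], [cofree_inj]).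
    Therefore module morphisms [Y ⊗_A X → DA] are balanced morphisms
    [YX → K], which are module morphisms [Y → DX] ([dual_mod_homP]): the module
    [DX] represents the functor as required ([evT_universal]), and the
    dualizing functor of [C_A] is [D] on underlying morphisms
    ([dual_map_modE]).  It is fully faithful because a morphism [f] of [C] is a
    module morphism as soon as [Df] is one ([dual_map_mod_hom]).  It is
    essentially surjective because an action on [DV] comes from one on [V]: the
    relation between the action on [X] and that on [DX] is symmetric, and the
    pairing is nondegenerate on both sides ([adjoint_action_left],
    [adjoint_action_right]).

    Associators.  All computations are done on products bracketed to the right.
    A morphism [f : XY → W] is applied to the first two factors of [X(YZ)] as
    [ext f Z], two neighbours are braided by [brx], and a morphism [AX → Y] is
    applied across a factor [P] by [slide].  The lemmas on these three operations
    absorb the pentagon and the hexagons; afterwards string diagram arguments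
    become rewriting of composites. *)

(** * Isomorphisms, coequalizers and kernels in a linear category *)

Section Composition.
Variables (k : fieldType) (C : lincat k).

(** Composites are kept bracketed to the left, where the source of an equation
    [g ∘ f = r] is not a subterm once something follows it.  [at2] and [at3]
    turn the equation into one that rewrites inside such a chain. *)
Lemma at2 (X Y Z W : C) (g : mor Y Z) (f : mor X Y) (r : mor X Z) :
  g ∘ f = r -> forall h : mor Z W, h ∘ g ∘ f = h ∘ r.
Proof. by move=> <- h; rewrite compmA. Qed.

Lemma at3 (X X' Y Z W : C) (g : mor Y Z) (f : mor X' Y) (e : mor X X')
    (r : mor X Z) :
  g ∘ f ∘ e = r -> forall h : mor Z W, h ∘ g ∘ f ∘ e = h ∘ r.
Proof. by move=> <- h; rewrite !compmA. Qed.

Lemma iso_epi (X Y : C) (f : mor X Y) : is_iso f -> epi f.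
Proof.
move=> [f' [_ ff']] Z g h e.
by rewrite -(comp_idr g) -(comp_idr h) -ff' !compmA e.
Qed.

Lemma iso_mono (X Y : C) (f : mor X Y) : is_iso f -> mono f.
Proof.
move=> [f' [f'f _]] Z g h e.
by rewrite -(comp_idl g) -(comp_idl h) -f'f -!compmA e.
Qed.

Lemma epi_comp (X Y Z : C) (g : mor Y Z) (f : mor X Y) :
  epi g -> epi f -> epi (g ∘ f).
Proof. by move=> eg ef W u v; rewrite !compmA => /ef/eg. Qed.

Lemma is_iso_comp (X Y Z : C) (g : mor Y Z) (f : mor X Y) :
  is_iso g -> is_iso f -> is_iso (g ∘ f).
Proof.
move=> [g' [g'g gg']] [f' [f'f ff']]; exists (f' ∘ g'); split.
  by rewrite compmA (at2 g'g) comp_idr f'f.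
by rewrite compmA (at2 ff') comp_idr gg'.
Qed.

Lemma coequalizer_epi (X Y Q : C) (f g : mor X Y) (p : mor Y Q) :
  is_coequalizer f g p -> epi p.
Proof.
move=> [pfg up] Z u v e.
have vfg : (v ∘ p) ∘ f = (v ∘ p) ∘ g by rewrite -!compmA pfg.
by have [t [_ ut]] := up _ _ vfg; rewrite -(ut u e) -(ut v erefl).
Qed.

Lemma coequalizer_pre (X X' Y Q : C) (f g : mor X Y) (p : mor Y Q)
    (u : mor X' X) :
  epi u -> is_coequalizer f g p <-> is_coequalizer (f ∘ u) (g ∘ u) p.
Proof.
move=> eu; split=> -[pfg up]; split.
- by rewrite !compmA pfg.
- by move=> Z h; rewrite !compmA => /eu; apply: up.
- by apply: eu; rewrite -!compmA.
- by move=> Z h e; apply: up; rewrite !compmA e.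
Qed.

Lemma comp0m (X Y Z : C) (f : mor X Y) : (0 : mor Y Z) ∘ f = 0.
Proof.
have /= := comp_linl (-1) (0 : mor Y Z) 0 f.
by rewrite !scaleN1r !addNr.
Qed.

Lemma compm0 (X Y Z : C) (g : mor Y Z) : g ∘ (0 : mor X Y) = 0.
Proof.
have /= := comp_linr (-1) g (0 : mor X Y) 0.
by rewrite !scaleN1r !addNr.
Qed.

Lemma compDm (X Y Z : C) (g g' : mor Y Z) (f : mor X Y) :
  (g + g') ∘ f = g ∘ f + g' ∘ f.
Proof. by have := comp_linl 1 g g' f; rewrite !scale1r. Qed.

Lemma compmD (X Y Z : C) (g : mor Y Z) (f f' : mor X Y) :
  g ∘ (f + f') = g ∘ f + g ∘ f'.
Proof. by have := comp_linr 1 g f f'; rewrite !scale1r. Qed.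

Lemma compBm (X Y Z : C) (g g' : mor Y Z) (f : mor X Y) :
  (g - g') ∘ f = g ∘ f - g' ∘ f.
Proof. by have := comp_linl (-1) g' g f; rewrite !scaleN1r !(addrC (- _)). Qed.

Lemma compmB (X Y Z : C) (g : mor Y Z) (f f' : mor X Y) :
  g ∘ (f - f') = g ∘ f - g ∘ f'.
Proof. by have := comp_linr (-1) g f' f; rewrite !scaleN1r !(addrC (- _)). Qed.

End Composition.

Section ZeroMorphisms.
Variables (k : fieldType) (C : lincat k).

Lemma mono_zero (X Y : C) (f : mor X Y) :
  (forall Z (g : mor Z X), f ∘ g = 0 -> g = 0) -> mono f.
Proof.
move=> f0 Z g h e; apply/eqP; rewrite -subr_eq0; apply/eqP/f0.
by rewrite compmB e subrr.
Qed.

Lemma epi_zero (X Y : C) (f : mor X Y) :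
  (forall Z (g : mor Y Z), g ∘ f = 0 -> g = 0) -> epi f.
Proof.
move=> f0 Z g h e; apply/eqP; rewrite -subr_eq0; apply/eqP/f0.
by rewrite compBm e subrr.
Qed.

Lemma kernel_mono (N X Y : C) (f : mor X Y) (i : mor N X) :
  is_kernel f i -> mono i.
Proof.
move=> [fi up] Z g h e.
have [t [_ ut]] := up _ (i ∘ h) (etrans (compmA _ _ _)
  (etrans (congr1 (fun u => u ∘ h) fi) (comp0m _ _))).
by rewrite -(ut h erefl) -(ut g e).
Qed.

Lemma cokernel_coequalizer (X Y Q : C) (f : mor X Y) (p : mor Y Q) :
  is_cokernel f p <-> is_coequalizer f 0 p.
Proof.
split=> -[pf up]; split.
- by rewrite pf compm0.
- by move=> Z h; rewrite compm0; apply: up.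
- by rewrite pf compm0.
- by move=> Z h hf; apply: up; rewrite hf compm0.
Qed.

Lemma coequalizer_cokernel (X Y Q : C) (f g : mor X Y) (p : mor Y Q) :
  is_cokernel (f - g) p -> is_coequalizer f g p.
Proof.
move=> [pf up]; split.
  by apply/eqP; rewrite -subr_eq0 -compmB pf.
by move=> Z h e; apply: up; rewrite compmB e subrr.
Qed.

Lemma cokernel_epi (X Y Q : C) (f : mor X Y) (p : mor Y Q) :
  is_cokernel f p -> epi p.
Proof. by move/cokernel_coequalizer/coequalizer_epi. Qed.

(** [g] factors through [p], so [g] kills whatever [p] kills. *)
Lemma kernel_of_cokernel (X Y Z Q : C) (f : mor X Y) (g : mor Y Z)
    (p : mor Y Q) : is_kernel g f -> is_cokernel f p -> is_kernel p f.
Proof.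
move=> [gf up] [pf uq]; split=> // W h ph; apply: up.
have [t [tp _]] := uq _ _ gf.
by rewrite -tp -compmA ph compm0.
Qed.

Lemma cokernel_of_kernel (X Y Z N : C) (f : mor X Y) (g : mor Z X)
    (i : mor N X) : is_cokernel g f -> is_kernel f i -> is_cokernel i f.
Proof.
move=> [fg up] [fi uq]; split=> // W h hi; apply: up.
have [t [it _]] := uq _ _ fg.
by rewrite -it compmA hi comp0m.
Qed.

End ZeroMorphisms.

(** * Equivalences and adjoints *)

Section RightAdjoint.
Variables (k : fieldType) (C D : lincat k).

Definition has_right_adjoint (F : functor C D) : Prop :=
  forall W : D, exists (R : C) (eps : mor (F R) W),
    forall (Y : C) (h : mor (F Y) W), exists! phi : mor Y R, eps ∘ fmap F phi = h.

(** Morphisms out of [F X] correspond to morphisms out of [X], and the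
    correspondence is compatible with precomposition. *)
Lemma adjoint_coequalizer (F : functor C D) (X Y Q : C) (f g : mor X Y)
    (p : mor Y Q) :
  has_right_adjoint F -> is_coequalizer f g p ->
  is_coequalizer (fmap F f) (fmap F g) (fmap F p).
Proof.
move=> adjF coq; have [pfg up] := coq; split=> [|W h hfg].
  by rewrite -!fmap_comp pfg.
have [R [eps univ]] := adjF W.
have [phi [phiE _]] := univ _ h.
have phifg : phi ∘ f = phi ∘ g.
  have [psi [_ upsi]] := univ _ (h ∘ fmap F f).
  rewrite -(upsi (phi ∘ f)) ?(upsi (phi ∘ g)) //.
    by rewrite fmap_comp compmA phiE.
  by rewrite fmap_comp compmA phiE.
have [t [tp _]] := up _ _ phifg.
exists (eps ∘ fmap F t); split; first by rewrite -compmA -fmap_comp tp.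
move=> s sp; have [sig [sigE _]] := univ _ s.
rewrite -sigE; congr (_ ∘ fmap F _); apply: (coequalizer_epi coq).
have [psi [_ upsi]] := univ _ h.
rewrite tp -(upsi phi) // (upsi (sig ∘ p)) //.
by rewrite fmap_comp compmA sigE.
Qed.

End RightAdjoint.

Definition fully_faithful (k : fieldType) (C D : lincat k) (F : functor C D) :
    Prop :=
  forall (X Y : C) (g : mor (F X) (F Y)), exists! f : mor X Y, fmap F f = g.

Definition essentially_surjective (k : fieldType) (C D : lincat k)
    (F : functor C D) : Prop :=
  forall Y : D, exists (X : C) (t : mor (F X) Y), is_iso t.

Section Equivalence.
Variables (k : fieldType) (C D : lincat k) (F : functor C D).

Lemma equivalence_essentially_surjective :
  is_equivalence F -> essentially_surjective F.
Proof.
by move=> [G [_ [t [t_iso _]]]] Y; exists (G Y), (t Y); exact: t_iso Y.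
Qed.

(** Such an [H] determines [f] as a conjugate of [fmap H f] by the isomorphism. *)
Lemma natural_iso_id_faithful (E : lincat k) (H : functor E E) :
  naturally_isomorphic H (id_functor E) ->
  forall (X Y : E) (f g : mor X Y), fmap H f = fmap H g -> f = g.
Proof.
move=> [t [t_iso t_nat]] X Y f g e; apply: (iso_epi (t_iso X)).
by have /= := t_nat _ _ f; rewrite e => <-; apply: t_nat.
Qed.

(** The preimage of [g] is [fmap G g] conjugated by the unit.  That it is mapped
    to [g] is checked after applying [G], which is faithful as well. *)
Lemma equivalence_fully_faithful : is_equivalence F -> fully_faithful F.
Proof.
move=> [G [GF FG]] X Y g.
have faithF (X' Y' : C) (f f' : mor X' Y') : fmap F f = fmap F f' -> f = f'.
  by move=> e; apply: (natural_iso_id_faithful GF); rewrite /= e.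
have faithG (X' Y' : D) (f f' : mor X' Y') : fmap G f = fmap G f' -> f = f'.
  by move=> e; apply: (natural_iso_id_faithful FG); rewrite /= e.
have [t [t_iso t_nat]] := GF; have [t' [t'K tK]] := t_iso X.
exists (t Y ∘ fmap G g ∘ t'); split; last first.
  move=> f <-; have /= -> := t_nat _ _ f.
  by rewrite (at2 tK) comp_idr.
apply: faithG; apply: (iso_mono (t_iso Y)).
have /= -> := t_nat _ _ (t Y ∘ fmap G g ∘ t').
by rewrite (at2 t'K) comp_idr.
Qed.

Lemma fully_faithful_inj (X Y : C) (f g : mor X Y) :
  fully_faithful F -> fmap F f = fmap F g -> f = g.
Proof.
by move=> ff e; have [h [_ uh]] := ff _ _ (fmap F g); rewrite -(uh f e) -(uh g).
Qed.

End Equivalence.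

Lemma dependent_choice (A : Type) (B : A -> Type) (R : forall a, B a -> Prop) :
  (forall a, exists b, R a b) -> exists f : forall a, B a, forall a, R a (f a).
Proof.
move=> h; pose f a := constructive_indefinite_description _ (h a).
by exists (fun a => sval (f a)) => a; apply: svalP (f a).
Qed.

Lemma fully_faithful_equivalence (k : fieldType) (C D : lincat k)
    (F : functor C D) :
  fully_faithful F -> essentially_surjective F -> is_equivalence F.
Proof.
move=> ff es.
have inj (X Y : C) (f g : mor X Y) : fmap F f = fmap F g -> f = g.
  exact: fully_faithful_inj.
have pre (X Y : C) (g : mor (F X) (F Y)) : {f : mor X Y | fmap F f = g}.
  apply: constructive_indefinite_description.
  by have [f [fE _]] := ff _ _ g; exists f.
have /dependent_choice[G /dependent_choice[t t_iso]] := es.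
have /dependent_choice[s st] := t_iso.
have stK Y : s Y ∘ t Y = idm _ by case: (st Y).
have tsK Y : t Y ∘ s Y = idm _ by case: (st Y).
pose Gm X Y (f : mor X Y) := pre _ _ (s Y ∘ f ∘ t X).
have G_id X : sval (Gm X X (idm X)) = idm (G X).
  by apply: inj; rewrite (svalP (Gm _ _ _)) comp_idr stK fmap_id.
have G_comp X Y Z (g : mor Y Z) (f : mor X Y) :
    sval (Gm X Z (g ∘ f)) = sval (Gm Y Z g) ∘ sval (Gm X Y f).
  apply: inj; rewrite fmap_comp !(svalP (Gm _ _ _)) !compmA.
  by rewrite (at2 (tsK Y)) comp_idr.
exists (Functor G_id G_comp); split; last first.
  exists t; split=> [X|X Y f /=]; first exact: t_iso.
  by rewrite (svalP (Gm _ _ _)) !compmA tsK comp_idl.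
exists (fun X => sval (pre _ _ (t (F X)))); split=> [X|X Y f /=].
  exists (sval (pre _ _ (s (F X)))); split; apply: inj;
    by rewrite fmap_comp !(svalP (pre _ _ _)) fmap_id ?stK ?tsK.
apply: inj; rewrite !fmap_comp (svalP (pre _ _ _)) (svalP (Gm _ _ _)).
by rewrite (svalP (pre _ _ _)) !compmA tsK comp_idl.
Qed.

(** * Tensor products bracketed to the right *)

Notation "f ▹[ M ] Z" := (tensm M f (idm Z))
  (at level 39, left associativity) : cat_scope.
Notation "X ◃[ M ] f" := (tensm M (idm X) f)
  (at level 39, left associativity) : cat_scope.

Section Monoidal.
Variables (k : fieldType) (C : lincat k) (I : C) (M : monoidal I).

Local Notation "X ⊗ Y" := (tens M X Y) (at level 39, left associativity).
Local Notation "f ▹ Z" := (tensm M f (idm Z)) (at level 39, left associativity).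
Local Notation "X ◃ f" := (tensm M (idm X) f) (at level 39, left associativity).
Local Notation ass := (assoc M).
Local Notation asi := (associ M).

Lemma whiskerlD (X Y Y' Y'' : C) (g : mor Y' Y'') (f : mor Y Y') :
  X ◃ (g ∘ f) = (X ◃ g) ∘ (X ◃ f).
Proof. by rewrite -tensm_comp comp_idl. Qed.

Lemma whiskerrD (X Y Y' Y'' : C) (g : mor Y' Y'') (f : mor Y Y') :
  (g ∘ f) ▹ X = (g ▹ X) ∘ (f ▹ X).
Proof. by rewrite -tensm_comp comp_idl. Qed.

Lemma whisker_swap (X X' Y Y' : C) (f : mor X X') (g : mor Y Y') :
  (f ▹ Y') ∘ (X ◃ g) = (X' ◃ g) ∘ (f ▹ Y).
Proof. by rewrite -!tensm_comp !comp_idl !comp_idr. Qed.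

Lemma tensmE (X X' Y Y' : C) (f : mor X X') (g : mor Y Y') :
  f ⊠[M] g = (f ▹ Y') ∘ (X ◃ g).
Proof. by rewrite -!tensm_comp !comp_idl !comp_idr. Qed.

Lemma assocK (X Y Z : C) : asi X Y Z ∘ ass X Y Z = idm _.
Proof. by case: (assoc_inv M X Y Z). Qed.

Lemma associK (X Y Z : C) : ass X Y Z ∘ asi X Y Z = idm _.
Proof. by case: (assoc_inv M X Y Z). Qed.

Lemma assoc_iso (X Y Z : C) : is_iso (ass X Y Z).
Proof. by exists (asi X Y Z); apply: assoc_inv. Qed.

Lemma associ_iso (X Y Z : C) : is_iso (asi X Y Z).
Proof. by exists (ass X Y Z); split; [apply: associK|apply: assocK]. Qed.

Lemma is_iso_whiskerl (X Y Z : C) (f : mor Y Z) : is_iso f -> is_iso (X ◃ f).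
Proof.
by move=> [g [gf fg]]; exists (X ◃ g); split; rewrite -whiskerlD ?gf ?fg tensm_id.
Qed.

Lemma is_iso_whiskerr (X Y Z : C) (f : mor Y Z) : is_iso f -> is_iso (f ▹ X).
Proof.
by move=> [g [gf fg]]; exists (g ▹ X); split; rewrite -whiskerrD ?gf ?fg tensm_id.
Qed.

Lemma associ_nat (X X' Y Y' Z Z' : C)
    (f : mor X X') (g : mor Y Y') (h : mor Z Z') :
  asi X' Y' Z' ∘ (f ⊠[M] (g ⊠[M] h)) = ((f ⊠[M] g) ⊠[M] h) ∘ asi X Y Z.
Proof.
apply: (iso_mono (assoc_iso X' Y' Z')); rewrite !compmA associK comp_idl assoc_nat.
by rewrite (at2 (associK _ _ _)) comp_idr.
Qed.

Lemma associ_pentagon (W X Y Z : C) :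
  (asi W X Y ▹ Z) ∘ asi W (X ⊗ Y) Z =
  asi (W ⊗ X) Y Z ∘ asi W X (Y ⊗ Z) ∘ (W ◃ ass X Y Z).
Proof.
apply: (iso_epi (assoc_iso W (X ⊗ Y) Z)).
apply: (iso_epi (is_iso_whiskerr Z (assoc_iso W X Y))).
rewrite (at2 (assocK _ _ _)) comp_idr -whiskerrD assocK tensm_id.
rewrite (at3 (esym (pentagon _ _ _ _ _))) !compmA (at2 (assocK _ _ _)) comp_idr.
by rewrite assocK.
Qed.

Lemma lunit_faithful (X Y : C) (f g : mor X Y) : I ◃ f = I ◃ g -> f = g.
Proof.
by move=> e; apply: (iso_epi (lunit_iso M X)); rewrite -!lunit_nat e.
Qed.

Lemma runit_faithful (X Y : C) (f g : mor X Y) : f ▹ I = g ▹ I -> f = g.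
Proof.
by move=> e; apply: (iso_epi (runit_iso M X)); rewrite -!runit_nat e.
Qed.

(** Kelly's argument: the equation is proved after tensoring with [I], which loses
    nothing, and there it follows from the pentagon and the triangle. *)
Lemma lunit_tens (X Y : C) : lunit M (X ⊗ Y) ∘ ass I X Y = lunit M X ▹ Y.
Proof.
apply: lunit_faithful; rewrite whiskerlD.
apply: (iso_epi (assoc_iso I (I ⊗ X) Y)).
apply: (iso_epi (is_iso_whiskerr Y (assoc_iso I I X))).
rewrite (at3 (esym (pentagon _ _ _ _ _))) compmA triangle.
rewrite -assoc_nat -[RHS]compmA -whiskerrD triangle.
by rewrite -(tensm_id M X Y) assoc_nat.
Qed.

Lemma runit_tens (X Y : C) : (X ◃ runit M Y) ∘ ass X Y I = runit M (X ⊗ Y).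
Proof.
apply: runit_faithful; apply: (iso_mono (assoc_iso X Y I)).
rewrite whiskerrD compmA assoc_nat -[in LHS]triangle -[in RHS]triangle.
rewrite -(tensm_id M X Y) compmA assoc_nat !whiskerlD.
by rewrite -(compmA _ _ (ass (X ⊗ Y) I I)) pentagon !compmA.
Qed.

(** Unfolding is blocked: otherwise, matching a pattern of composition would
    decompose it. *)
Fact ext_key : unit. Proof. exact: tt. Qed.
Definition ext (X Y W : C) (f : mor (X ⊗ Y) W) (Z : C) :
    mor (X ⊗ (Y ⊗ Z)) (W ⊗ Z) :=
  locked_with ext_key ((f ▹ Z) ∘ asi X Y Z).

Lemma extE (X Y W Z : C) (f : mor (X ⊗ Y) W) : ext f Z = (f ▹ Z) ∘ asi X Y Z.
Proof. by rewrite /ext unlock. Qed.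

Lemma ext_assoc (X Y W Z : C) (f : mor (X ⊗ Y) W) :
  ext f Z ∘ ass X Y Z = f ▹ Z.
Proof. by rewrite extE (at2 (assocK _ _ _)) comp_idr. Qed.

(** Interchange: [ext f] does not see what is done to the last factor. *)
Lemma ext_nat (X Y W Z Z' : C) (f : mor (X ⊗ Y) W) (g : mor Z Z') :
  ext f Z' ∘ (X ◃ (Y ◃ g)) = (W ◃ g) ∘ ext f Z.
Proof.
by rewrite !extE (at2 (associ_nat _ _ _)) compmA tensm_id whisker_swap compmA.
Qed.

Lemma ext_post (X Y W W' Z : C) (f : mor (X ⊗ Y) W) (h : mor W W') :
  ext (h ∘ f) Z = (h ▹ Z) ∘ ext f Z.
Proof. by rewrite !extE whiskerrD compmA. Qed.

Lemma ext_prel (X X' Y W Z : C) (f : mor (X ⊗ Y) W) (u : mor X' X) :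
  ext (f ∘ (u ▹ Y)) Z = ext f Z ∘ (u ▹ (Y ⊗ Z)).
Proof. by rewrite !extE whiskerrD -tensm_id (at2 (associ_nat _ _ _)) compmA. Qed.

Lemma ext_prer (X Y Y' W Z : C) (f : mor (X ⊗ Y) W) (v : mor Y' Y) :
  ext (f ∘ (X ◃ v)) Z = ext f Z ∘ (X ◃ (v ▹ Z)).
Proof. by rewrite !extE whiskerrD (at2 (associ_nat _ _ _)) compmA. Qed.

(** Extending twice is extending once, up to associators: this is the pentagon. *)
Lemma ext_ext (X Y V W Z : C) (f : mor (X ⊗ Y) W) :
  ext (ext f V) Z = asi W V Z ∘ ext f (V ⊗ Z) ∘ (X ◃ ass Y V Z).
Proof.
rewrite !extE whiskerrD -compmA associ_pentagon !compmA.
by rewrite -tensm_id associ_nat.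
Qed.

Lemma ext_lunit (X Y : C) : ext (lunit M X) Y = lunit M (X ⊗ Y).
Proof.
apply: (iso_epi (assoc_iso I X Y)).
by rewrite ext_assoc lunit_tens.
Qed.

End Monoidal.

(** Through the left unit isomorphisms, [I ◃ f] is [f]. *)
Lemma epi_whiskerl_unit (k : fieldType) (C : lincat k) (I : C)
    (M : monoidal I) (X Y : C) (f : mor X Y) : epi f -> epi (I ◃[M] f).
Proof.
move=> ef; have [l [lK Kl]] := lunit_iso M X.
have [l' [l'K Kl']] := lunit_iso M Y.
have -> : I ◃[M] f = l' ∘ (f ∘ lunit M X).
  by rewrite -lunit_nat compmA l'K comp_idl.
apply: epi_comp; first by apply: iso_epi; exists (lunit M Y).
by apply: epi_comp => //; apply: iso_epi; exists l.
Qed.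

(** * Braidings past a factor *)

Section Braided.
Variables (k : fieldType) (C : lincat k) (I : C) (M : monoidal I).
Variable c : braiding M.

Local Notation "X ⊗ Y" := (tens M X Y) (at level 39, left associativity).
Local Notation "f ▹ Z" := (tensm M f (idm Z)) (at level 39, left associativity).
Local Notation "X ◃ f" := (tensm M (idm X) f) (at level 39, left associativity).
Local Notation ass := (assoc M).
Local Notation asi := (associ M).

Lemma br_natl (X X' Y : C) (f : mor X X') : c X' Y ∘ (f ▹ Y) = (Y ◃ f) ∘ c X Y.
Proof. exact: br_nat. Qed.

Lemma br_natr (X Y Y' : C) (f : mor Y Y') : c X Y' ∘ (X ◃ f) = (f ▹ X) ∘ c X Y.
Proof. exact: br_nat. Qed.

Fact brx_key : unit. Proof. exact: tt. Qed.
Definition brx (X Y Z : C) : mor (X ⊗ (Y ⊗ Z)) (Y ⊗ (X ⊗ Z)) :=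
  locked_with brx_key (ass Y X Z ∘ ext (c X Y) Z).

Lemma brxE (X Y Z : C) : brx X Y Z = ass Y X Z ∘ ext (c X Y) Z.
Proof. by rewrite /brx unlock. Qed.

Lemma brx_iso X Y Z : is_iso (brx X Y Z).
Proof.
rewrite brxE extE; apply: is_iso_comp; first exact: assoc_iso.
apply: is_iso_comp; last exact: associ_iso.
exact/is_iso_whiskerr/br_iso.
Qed.

Lemma brx_nat1 (X X' Y Z : C) (f : mor X X') :
  brx X' Y Z ∘ (f ▹ (Y ⊗ Z)) = (Y ◃ (f ▹ Z)) ∘ brx X Y Z.
Proof.
rewrite !brxE -compmA -ext_prel br_natl ext_post !compmA.
by rewrite assoc_nat.
Qed.

Lemma brx_nat2 (X Y Y' Z : C) (f : mor Y Y') :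
  brx X Y' Z ∘ (X ◃ (f ▹ Z)) = (f ▹ (X ⊗ Z)) ∘ brx X Y Z.
Proof.
rewrite !brxE -compmA -ext_prer br_natr ext_post !compmA.
by rewrite assoc_nat tensm_id.
Qed.

Lemma brx_nat3 (X Y Z Z' : C) (f : mor Z Z') :
  brx X Y Z' ∘ (X ◃ (Y ◃ f)) = (Y ◃ (X ◃ f)) ∘ brx X Y Z.
Proof. by rewrite !brxE -compmA ext_nat !compmA -tensm_id assoc_nat. Qed.

Lemma brx_assoc (X Y Z : C) : brx X Y Z ∘ ass X Y Z = ass Y X Z ∘ (c X Y ▹ Z).
Proof. by rewrite !brxE -compmA ext_assoc. Qed.

(** [brx_tensr] and [brx_tensl] are the two hexagons with one more factor [Z] on
    the right, so that no associator is left in front of a braiding. *)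
Lemma brx_tensr (X Y W Z : C) :
  brx X (Y ⊗ W) Z ∘ (X ◃ asi Y W Z) =
  asi Y W (X ⊗ Z) ∘ (Y ◃ brx X W Z) ∘ brx X Y (W ⊗ Z).
Proof.
apply: (iso_epi (is_iso_whiskerl M X (assoc_iso M Y W Z))).
apply: (iso_epi (assoc_iso M X (Y ⊗ W) Z)).
apply: (iso_epi (is_iso_whiskerr M Z (assoc_iso M X Y W))).
apply: (iso_mono (assoc_iso M Y W (X ⊗ Z))).
rewrite !compmA associK comp_idl.
rewrite (at2 (esym (whiskerlD _ _ _ _))) assocK tensm_id comp_idr.
rewrite (at2 (brx_assoc _ _ _)) !compmA (at2 (esym (whiskerrD _ _ _ _))).
rewrite pentagon (at2 (esym (whiskerrD _ _ _ _))) !compmA hexagon1.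
rewrite (at3 (esym (pentagon _ _ _ _ _))) !compmA (at2 (brx_assoc _ _ _)).
rewrite !compmA -(tensm_id M W Z) (at2 (esym (assoc_nat _ _ _ _))) compmA.
rewrite (at2 (pentagon _ _ _ _ _)) !compmA.
rewrite -(whiskerlD M Y (brx X W Z)) brx_assoc whiskerlD.
rewrite (at2 (esym (assoc_nat _ _ _ _))).
by rewrite !whiskerrD !compmA.
Qed.

Lemma brx_tensl (X W Y Z : C) :
  brx (X ⊗ W) Y Z ∘ asi X W (Y ⊗ Z) =
  (Y ◃ asi X W Z) ∘ brx X Y (W ⊗ Z) ∘ (X ◃ brx W Y Z).
Proof.
have hex : asi Y X W ∘ c (X ⊗ W) Y =
    (c X Y ▹ W) ∘ asi X Y W ∘ (X ◃ c W Y) ∘ ass X W Y.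
  by rewrite -hexagon2 (at2 (assocK _ _ _ _)) comp_idr.
apply: (iso_epi (assoc_iso M X W (Y ⊗ Z))).
apply: (iso_epi (assoc_iso M (X ⊗ W) Y Z)).
apply: (iso_mono (is_iso_whiskerl M Y (assoc_iso M X W Z))).
rewrite !compmA -(whiskerlD M Y (ass X W Z)) associK tensm_id comp_idl.
rewrite (at2 (assocK _ _ _ _)) comp_idr (at2 (brx_assoc _ _ _)) compmA.
rewrite (at2 (pentagon _ _ _ _ _)) !compmA.
rewrite (at2 (esym (whiskerlD _ _ _ _))) brx_assoc whiskerlD !compmA.
rewrite (at2 (esym (assoc_nat _ _ _ _))) !compmA.
have -> : brx X Y (W ⊗ Z) ∘ (X ◃ ass Y W Z) ∘ ass X (Y ⊗ W) Z =
    ass Y X (W ⊗ Z) ∘ ass (Y ⊗ X) W Z ∘ ((c X Y ▹ W) ▹ Z) ∘ (asi X Y W ▹ Z).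
  apply: (iso_epi (is_iso_whiskerr M Z (assoc_iso M X Y W))).
  rewrite (at3 (esym (pentagon _ _ _ _ _))) (at2 (esym (whiskerrD _ _ _ _))).
  rewrite assocK tensm_id comp_idr compmA brx_assoc.
  by rewrite -[RHS]compmA assoc_nat tensm_id compmA.
have -> : (Y ◃ ass X W Z) ∘ ass Y (X ⊗ W) Z =
    ass Y X (W ⊗ Z) ∘ ass (Y ⊗ X) W Z ∘ (asi Y X W ▹ Z).
  apply: (iso_epi (is_iso_whiskerr M Z (assoc_iso M Y X W))).
  by rewrite -pentagon (at2 (esym (whiskerrD _ _ _ _))) assocK tensm_id comp_idr.
by rewrite (at2 (esym (whiskerrD _ _ _ _))) hex !whiskerrD !compmA.
Qed.

(** A strand that crosses both inputs of [f] may as well cross its output. *)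
Lemma brx_extr (X Y W V Z : C) (f : mor (Y ⊗ W) V) :
  brx X V Z ∘ (X ◃ ext f Z) =
  ext f (X ⊗ Z) ∘ (Y ◃ brx X W Z) ∘ brx X Y (W ⊗ Z).
Proof.
by rewrite !extE whiskerlD compmA brx_nat2 (at2 (brx_tensr _ _ _ _)) !compmA.
Qed.

Lemma brx_extl (X Y W V Z : C) (f : mor (X ⊗ W) V) :
  brx V Y Z ∘ ext f (Y ⊗ Z) =
  (Y ◃ ext f Z) ∘ brx X Y (W ⊗ Z) ∘ (X ◃ brx W Y Z).
Proof.
by rewrite !extE whiskerlD compmA brx_nat1 (at2 (brx_tensl _ _ _ _)) !compmA.
Qed.

(** In the hexagon for [I], [I] and [P], the braiding of [I ⊗ I] with [P] is
    [c I P] up to unit isomorphisms, and equals two successive copies of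
    [c I P]; cancelling one copy leaves the claim. *)
Lemma br_unit (P : C) : runit M P ∘ c I P = lunit M P.
Proof.
apply: runit_faithful.
apply: (iso_epi (associ_iso M I P I)).
apply: (iso_epi (is_iso_whiskerl M I (br_iso c I P))).
rewrite whiskerrD (at3 (esym (hexagon2 _ _ _ _))) -triangle !compmA.
rewrite (at2 (associK _ _ _ _)) comp_idr -br_natl.
by rewrite -compmA -!extE !ext_lunit lunit_nat.
Qed.

Lemma brx_unit (P X : C) : (P ◃ lunit M X) ∘ brx I P X = lunit M (P ⊗ X).
Proof.
rewrite brxE extE !compmA triangle -compmA -extE -ext_post.
by rewrite br_unit ext_lunit.
Qed.

End Braided.

Section Slide.
Variables (k : fieldType) (C : lincat k) (I : C) (M : monoidal I).
Variable c : braiding M.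

Local Notation "X ⊗ Y" := (tens M X Y) (at level 39, left associativity).
Local Notation "f ▹ Z" := (tensm M f (idm Z)) (at level 39, left associativity).
Local Notation "X ◃ f" := (tensm M (idm X) f) (at level 39, left associativity).
Local Notation ass := (assoc M).
Local Notation asi := (associ M).
Local Notation brx := (brx c).

(** The strand [A] crosses [P] on its way to [X]; for an action [w] of an algebra
    on [X] this is the action on the second factor of [P ⊗ X]. *)
Fact slide_key : unit. Proof. exact: tt. Qed.
Definition slide (A X Y : C) (w : mor (A ⊗ X) Y) (P : C) :
    mor (A ⊗ (P ⊗ X)) (P ⊗ Y) :=
  locked_with slide_key ((P ◃ w) ∘ brx A P X).

Lemma slideE (A X Y : C) (w : mor (A ⊗ X) Y) (P : C) :
  slide w P = (P ◃ w) ∘ brx A P X.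
Proof. by rewrite /slide unlock. Qed.

Lemma slide_post (A X Y Y' P : C) (w : mor (A ⊗ X) Y) (h : mor Y Y') :
  slide (h ∘ w) P = (P ◃ h) ∘ slide w P.
Proof. by rewrite !slideE whiskerlD compmA. Qed.

Lemma slide_prer (A X X' Y P : C) (w : mor (A ⊗ X) Y) (v : mor X' X) :
  slide (w ∘ (A ◃ v)) P = slide w P ∘ (A ◃ (P ◃ v)).
Proof. by rewrite !slideE whiskerlD (at2 (brx_nat3 _ _ _ _)) compmA. Qed.

Lemma slide_prel (A A' X Y P : C) (w : mor (A ⊗ X) Y) (u : mor A' A) :
  slide (w ∘ (u ▹ X)) P = slide w P ∘ (u ▹ (P ⊗ X)).
Proof. by rewrite !slideE whiskerlD (at2 (brx_nat1 _ _ _ _)) compmA. Qed.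

Lemma slide_nat (A X Y P P' : C) (w : mor (A ⊗ X) Y) (f : mor P P') :
  slide w P' ∘ (A ◃ (f ▹ X)) = (f ▹ Y) ∘ slide w P.
Proof. by rewrite !slideE (at2 (brx_nat2 _ _ _ _)) !compmA whisker_swap. Qed.

Lemma slide_lunit (X P : C) : slide (lunit M X) P = lunit M (P ⊗ X).
Proof. by rewrite slideE brx_unit. Qed.

Lemma slide_ext (A B D X Y P : C) (m : mor (A ⊗ B) D) (w : mor (D ⊗ X) Y) :
  slide w P ∘ ext m (P ⊗ X) = slide (w ∘ ext m X) P ∘ (A ◃ brx B P X).
Proof. by rewrite !slideE whiskerlD -!compmA brx_extl !compmA. Qed.

Lemma slide_slide (A B X Y Z P : C) (w : mor (A ⊗ Y) Z) (v : mor (B ⊗ X) Y) :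
  slide w P ∘ (A ◃ slide v P) = slide (w ∘ (A ◃ v)) P ∘ (A ◃ brx B P X).
Proof.
rewrite !slideE !whiskerlD !compmA.
by rewrite (at2 (brx_nat3 _ _ _ _)) compmA.
Qed.

(** The string diagrams agree after [a] is pulled below the strand [B]; what
    remains is the crossing of the two acting strands. *)
Lemma slide_ext_comm (A B X X' Y Y' : C) (a : mor (A ⊗ X) X')
    (b : mor (B ⊗ Y) Y') :
  slide b X' ∘ (B ◃ ext a Y) = ext a Y' ∘ (A ◃ slide b X) ∘ brx B A (X ⊗ Y).
Proof.
by rewrite !slideE (at2 (brx_extr _ _ _ _)) whiskerlD !compmA ext_nat.
Qed.

Lemma slide_assoc (A P X Y : C) (w : mor (A ⊗ X) Y) :
  slide w P ∘ assoc M A P X = (P ◃ w) ∘ assoc M P A X ∘ (c A P ▹ X).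
Proof. by rewrite slideE (at2 (brx_assoc _ _ _ _)) compmA. Qed.

Lemma slide_tens (A P Q X Y : C) (w : mor (A ⊗ X) Y) :
  slide w (P ⊗ Q) ∘ (A ◃ associ M P Q X) =
  associ M P Q Y ∘ slide (slide w Q) P.
Proof.
rewrite !slideE (at2 (brx_tensr _ _ _ _ _)) whiskerlD -tensm_id !compmA.
by rewrite associ_nat.
Qed.

(** The next two lemmas are the hexagons once more, for a crossing at the right
    end of a product. *)
Lemma br_extr (A B X Y : C) (a : mor (A ⊗ X) Y) :
  c B Y ∘ (B ◃ a) = ext a B ∘ (A ◃ c B X) ∘ brx B A X.
Proof.
rewrite br_natr brxE !extE !compmA.
apply: (iso_epi (assoc_iso M B A X)).
rewrite (at2 (assocK _ _ _ _)) comp_idr (at3 (esym (hexagon1 _ _ _ _))).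
by rewrite !compmA (at2 (assocK _ _ _ _)) comp_idr.
Qed.

Lemma br_extl (A B D X : C) (m : mor (A ⊗ B) D) :
  c D X ∘ ext m X = (X ◃ m) ∘ brx A X B ∘ (A ◃ c B X).
Proof.
rewrite extE compmA br_natl brxE extE !compmA.
rewrite (at3 (esym (hexagon2 _ _ _ _))) !compmA.
by rewrite (at2 (associK _ _ _ _)) comp_idr.
Qed.

Lemma ext_slide (A P X Y Z : C) (w : mor (A ⊗ X) Y) :
  ass P Y Z ∘ ext (slide w P) Z = slide (ext w Z) P ∘ (A ◃ ass P X Z).
Proof.
apply: (iso_epi (assoc_iso M A (P ⊗ X) Z)).
apply: (iso_epi (is_iso_whiskerr M Z (assoc_iso M A P X))).
rewrite (at2 (ext_assoc _ _)) -!compmA (compmA (A ◃ ass P X Z)) -pentagon.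
rewrite -whiskerrD slide_assoc !compmA slide_assoc !whiskerrD !compmA.
rewrite assoc_nat -[in RHS](tensm_id M X Z) (at2 (esym (assoc_nat _ _ _ _))).
rewrite compmA (at2 (pentagon _ _ _ _ _)) !compmA extE whiskerlD.
by rewrite (at2 (esym (whiskerlD M P (asi A X Z) _))) assocK tensm_id comp_idr.
Qed.

End Slide.

(** * Tensor products in a Grothendieck-Verdier category *)

Section Closed.
Variables (k : fieldType) (C : lincat k) (I : C) (M : monoidal I).
Variables (c : braiding M) (K : C) (D : dualizing M K).

Local Notation "X ⊗ Y" := (tens M X Y) (at level 39, left associativity).
Local Notation "f ▹ Z" := (tensm M f (idm Z)) (at level 39, left associativity).
Local Notation "X ◃ f" := (tensm M (idm X) f) (at level 39, left associativity).
Local Notation DD := (dual_ob D).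

Definition tensor_right (Z : C) : functor C C :=
  @Functor k C C (fun X => X ⊗ Z) (fun _ _ f => f ▹ Z)
    (fun X => tensm_id M X Z) (fun _ _ _ g f => whiskerrD M Z g f).

Definition tensor_left (Z : C) : functor C C :=
  @Functor k C C (fun X => Z ⊗ X) (fun _ _ f => Z ◃ f)
    (fun X => tensm_id M Z X) (fun _ _ _ g f => whiskerlD M Z g f).

Lemma ev_inj (X Y : C) (f g : mor Y (DD X)) :
  ev D X ∘ (f ▹ X) = ev D X ∘ (g ▹ X) -> f = g.
Proof. by move=> e; rewrite -(transpose_uniq e); apply: transpose_uniq. Qed.

Lemma dual_ob_surj (W : C) : exists (V : C) (t : mor (DD V) W), is_iso t.
Proof.
by have es := equivalence_essentially_surjective (dualizing_equiv D); apply: es.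
Qed.

Lemma dual_map_surj (X Y : C) (g : mor (DD Y) (DD X)) :
  exists f : mor X Y, dual_map D f = g.
Proof.
have [f [fE _]] := equivalence_fully_faithful (dualizing_equiv D) g.
by exists f.
Qed.

Lemma dual_map_ev (X Y : C) (f : mor X Y) :
  ev D X ∘ (dual_map D f ▹ X) = ev D Y ∘ (DD Y ◃ f).
Proof. exact: transposeP. Qed.

(** The evaluation is also nondegenerate in its second argument, because the
    dualizing functor is faithful. *)
Lemma coev_inj (X Y : C) (f g : mor X Y) :
  ev D Y ∘ (DD Y ◃ f) = ev D Y ∘ (DD Y ◃ g) -> f = g.
Proof.
move=> e; have ff := equivalence_fully_faithful (dualizing_equiv D).
apply: (fully_faithful_inj (C := opposite C) ff).
by rewrite /= /dual_map e.
Qed.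

(** Closedness.  If [t : DV → W] is an isomorphism, the object of morphisms from
    [Z] to [W] is [D (Z ⊗ V)]: both [Y → D (Z ⊗ V)] and [Y ⊗ Z → DV] are
    transposes of morphisms [Y ⊗ Z ⊗ V → K]. *)
Lemma tensor_right_adjoint (Z : C) : has_right_adjoint (tensor_right Z).
Proof.
move=> W; have [V [t [s [st ts]]]] := dual_ob_surj W.
pose u : mor (DD (Z ⊗ V) ⊗ Z) (DD V) :=
  transpose D (ev D (Z ⊗ V) ∘ assoc M _ Z V).
have uE (Y : C) (phi : mor Y (DD (Z ⊗ V))) :
    ev D V ∘ ((u ∘ (phi ▹ Z)) ▹ V) = ev D _ ∘ (phi ▹ (Z ⊗ V)) ∘ assoc M Y Z V.
  rewrite whiskerrD compmA transposeP (at2 (assoc_nat _ _ _ _)).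
  by rewrite tensm_id compmA.
exists (DD (Z ⊗ V)), (t ∘ u) => Y h /=.
exists (transpose D (ev D V ∘ ((s ∘ h) ▹ V) ∘ associ M Y Z V)); split.
  rewrite -compmA -[RHS]comp_idl -ts -[RHS]compmA; congr (_ ∘ _).
  apply: ev_inj; rewrite uE transposeP.
  by rewrite (at2 (assocK _ _ _ _)) comp_idr.
move=> phi phiE; apply: transpose_uniq; rewrite -phiE !compmA st comp_idl uE.
by rewrite (at2 (associK _ _ _ _)) comp_idr.
Qed.

(** The braiding turns [Z ⊗ -] into [- ⊗ Z]. *)
Lemma tensor_left_adjoint (Z : C) : has_right_adjoint (tensor_left Z).
Proof.
move=> W; have [R [eps univ]] := tensor_right_adjoint Z W.
have [b [bK Kb]] : is_iso (c R Z) by apply: br_iso.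
exists R, (eps ∘ b) => Y h /=.
have [phi [phiE uphi]] := univ _ (h ∘ c Y Z).
have natb (psi : mor Y R) : b ∘ (Z ◃ psi) ∘ c Y Z = psi ▹ Z.
  by rewrite -compmA -br_natl compmA bK comp_idl.
exists phi; split.
  apply: (iso_epi (br_iso c Y Z)); rewrite -!compmA (compmA b) natb.
  exact: phiE.
move=> psi psiE; apply: uphi.
by rewrite -psiE /= -natb !compmA.
Qed.

Lemma tensr_coequalizer (X Y Q Z : C) (f g : mor X Y) (p : mor Y Q) :
  is_coequalizer f g p -> is_coequalizer (f ▹ Z) (g ▹ Z) (p ▹ Z).
Proof. exact: (adjoint_coequalizer (tensor_right_adjoint Z)). Qed.

Lemma tensl_coequalizer (X Y Q Z : C) (f g : mor X Y) (p : mor Y Q) :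
  is_coequalizer f g p -> is_coequalizer (Z ◃ f) (Z ◃ g) (Z ◃ p).
Proof. exact: (adjoint_coequalizer (tensor_left_adjoint Z)). Qed.

End Closed.

(** * Actions and modules *)

Section Actions.
Variables (k : fieldType) (C : lincat k) (I : C) (M : monoidal I).
Variable c : braiding M.
Variable A : algebra M.

Local Notation "X ⊗ Y" := (tens M X Y) (at level 39, left associativity).
Local Notation "f ▹ Z" := (tensm M f (idm Z)) (at level 39, left associativity).
Local Notation "X ◃ f" := (tensm M (idm X) f) (at level 39, left associativity).
Local Notation brx := (brx c).
Local Notation slide := (slide c).

Lemma actionE (X : C) (a : mor (A ⊗ X) X) :
  is_action a <->
  a ∘ ext (amul A) X = a ∘ (acar A ◃ a) /\ a ∘ (aone A ▹ X) = lunit M X.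
Proof.
split=> -[aM a1]; split=> //.
  by rewrite extE compmA aM (at2 (associK _ _ _ _)) comp_idr.
by rewrite -aM -compmA ext_assoc.
Qed.

Lemma ext_action (X Z : C) (a : mor (A ⊗ X) X) :
  is_action a -> is_action (ext a Z).
Proof.
move=> /actionE[aM a1]; apply/actionE; split; last first.
  by rewrite -ext_prel a1 ext_lunit.
have := congr1 (fun f => ext f Z) aM.
rewrite /= ext_post ext_ext ext_prer => e.
apply: (iso_epi (is_iso_whiskerl M A (assoc_iso M A X Z))).
rewrite -[RHS]compmA -whiskerlD ext_assoc -e.
by rewrite !compmA -extE.
Qed.

Lemma slide_action (P X : C) (a : mor (A ⊗ X) X) :
  is_action a -> is_action (slide a P).
Proof.
move=> /actionE[aM a1]; apply/actionE; split; last first.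
  by rewrite -slide_prel a1 slide_lunit.
by rewrite slide_ext slide_slide aM.
Qed.

Lemma ext_amul_comm (commA : commutative_algebra c A) (X : C) :
  ext (amul A) X ∘ brx A A X = ext (amul A) X.
Proof. by rewrite brxE compmA ext_assoc -ext_post commA. Qed.

(** The action [a] descends to [Q] if [q ∘ a] coequalizes [A ◃ a] and [A ◃ b].
    Up to braiding the two copies of [A], [q ∘ a ∘ (A ◃ b)] is
    [q ∘ b ∘ (A ◃ a)], which is [q ∘ a ∘ (A ◃ a)].  This last morphism factors
    through the multiplication of [A], where commutativity absorbs the
    braiding. *)
Lemma coequalizer_action (commA : commutative_algebra c A) (P Q : C)
    (a b : mor (A ⊗ P) P) (q : mor P Q) :
  is_action a ->
  b ∘ (acar A ◃ a) = a ∘ (acar A ◃ b) ∘ brx A A P ->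
  is_coequalizer a b q ->
  is_coequalizer (acar A ◃ a) (acar A ◃ b) (acar A ◃ q) ->
  epi (acar A ◃ (acar A ◃ q)) ->
  exists2 d : mor (A ⊗ Q) Q, is_action d & d ∘ (acar A ◃ q) = q ∘ a.
Proof.
move=> /actionE[aM a1] ab coq coAq epiAAq.
have [qab _] := coq.
have [|d [dq _]] := coAq.2 _ (q ∘ a).
  apply: (iso_epi (brx_iso c A A P)).
  by rewrite (at3 (esym ab)) compmA -qab !(at2 (esym aM)) !compmA
     (at2 (ext_amul_comm commA _)).
exists d => //; apply/actionE; split.
  apply: epiAAq; rewrite (at2 (ext_nat _ _)) compmA dq (at2 aM).
  by rewrite (at2 (esym (whiskerlD _ _ _ _))) dq whiskerlD !compmA dq.
apply: (epi_whiskerl_unit (coequalizer_epi coq)).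
by rewrite (at2 (whisker_swap _ _ _)) compmA dq (at2 a1) lunit_nat.
Qed.

End Actions.

Section Modules.
Variables (k : fieldType) (C : lincat k) (I : C) (M : monoidal I).
Variable A : algebra M.

Local Notation "X ⊗ Y" := (tens M X Y) (at level 39, left associativity).
Local Notation "f ▹ Z" := (tensm M f (idm Z)) (at level 39, left associativity).
Local Notation "X ◃ f" := (tensm M (idm X) f) (at level 39, left associativity).

Lemma mod_hom_lact (X Y : lmodule A) (f : mod_hom X Y) :
  mod_hom_val f ∘ lact X = lact Y ∘ (acar A ◃ mod_hom_val f).
Proof. exact/eqP/(mod_homP f). Qed.

Lemma lactM (X : lmodule A) :
  lact X ∘ ext (amul A) X = lact X ∘ (acar A ◃ lact X).
Proof. by have /actionE[] := actP X. Qed.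

Lemma lact1 (X : lmodule A) : lact X ∘ (aone A ▹ X) = lunit M X.
Proof. by have /actionE[] := actP X. Qed.

Definition mkmod_hom (X Y : lmodule A) (f : mor (mcar X) (mcar Y))
    (fP : f ∘ lact X = lact Y ∘ (acar A ◃ f)) : mod_hom X Y :=
  ModHom (introT eqP fP).

Lemma mod_hom_inj (X Y : lmodule A) (f g : mod_hom X Y) :
  mod_hom_val f = mod_hom_val g -> f = g.
Proof. exact: val_inj. Qed.

Lemma tensm0 (X Y Z : C) : X ◃ (0 : mor Y Z) = 0.
Proof.
have /= := tensm_linr M (-1) (idm X) (0 : mor Y Z) 0.
by rewrite !scaleN1r !addNr.
Qed.

Lemma mod_zero_object (Z : C) : is_zero_object Z ->
  exists Z' : mod_cat A, is_zero_object Z'.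
Proof.
move=> z; have zP : is_action (0 : mor (A ⊗ Z) Z) by split; apply: (z _).1.
exists (LModule zP) => X; split=> f g; apply: mod_hom_inj.
  exact: (z _).1.
exact: (z _).2.
Qed.

Lemma mod_biproduct (X Y : lmodule A) :
  has_biproduct (mcar X) (mcar Y) ->
  has_biproduct (X : mod_cat A) (Y : mod_cat A).
Proof.
move=> [P [i [j [p [q [pi qj pj qi ip_jq]]]]]].
pose a := i ∘ lact X ∘ (acar A ◃ p) + j ∘ lact Y ∘ (acar A ◃ q).
have pa : p ∘ a = lact X ∘ (acar A ◃ p).
  by rewrite compmD !compmA pi pj comp_idl !comp0m addr0.
have qa : q ∘ a = lact Y ∘ (acar A ◃ q).
  by rewrite compmD !compmA qi qj comp_idl !comp0m add0r.
have ai : a ∘ (acar A ◃ i) = i ∘ lact X.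
  rewrite compDm -!compmA -!whiskerlD pi qi tensm0 tensm_id !compm0 addr0.
  by rewrite comp_idr.
have aj : a ∘ (acar A ◃ j) = j ∘ lact Y.
  rewrite compDm -!compmA -!whiskerlD pj qj tensm0 tensm_id !compm0 add0r.
  by rewrite comp_idr.
have joint (Z : C) (u v : mor Z P) : p ∘ u = p ∘ v -> q ∘ u = q ∘ v -> u = v.
  move=> pu qu; rewrite -(comp_idl u) -(comp_idl v) -ip_jq !compDm -!compmA.
  by rewrite pu qu.
have aP : is_action a.
  apply/actionE; split; apply: joint; rewrite !compmA ?pa ?qa.
  - rewrite -compmA -ext_nat compmA lactM -[RHS]compmA -whiskerlD pa.
    by rewrite whiskerlD !compmA.
  - rewrite -compmA -ext_nat compmA lactM -[RHS]compmA -whiskerlD qa.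
    by rewrite whiskerlD !compmA.
  - by rewrite -compmA -whisker_swap compmA lact1 lunit_nat.
  - by rewrite -compmA -whisker_swap compmA lact1 lunit_nat.
exists (LModule aP), (@mkmod_hom X (LModule aP) i (esym ai)),
  (@mkmod_hom Y (LModule aP) j (esym aj)), (@mkmod_hom (LModule aP) X p pa),
  (@mkmod_hom (LModule aP) Y q qa).
by split; apply: mod_hom_inj.
Qed.

Lemma mod_kernel (X Y : lmodule A) (f : mod_hom X Y) (N : C)
    (i : mor N (mcar X)) : is_kernel (mod_hom_val f) i ->
  exists (a : mor (A ⊗ N) N) (aP : is_action a),
    i ∘ a = lact X ∘ (acar A ◃ i).
Proof.
move=> ker_i; have [fi up] := ker_i; have mono_i := kernel_mono ker_i.
have [|a [ia _]] := up _ (lact X ∘ (acar A ◃ i)).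
  by rewrite compmA mod_hom_lact -compmA -whiskerlD fi tensm0 compm0.
have aP : is_action a; last by exists a, aP.
apply/actionE; split; apply: mono_i; rewrite !compmA ia.
  rewrite -compmA -ext_nat compmA lactM -[RHS]compmA -whiskerlD ia.
  by rewrite whiskerlD !compmA.
by rewrite -compmA -whisker_swap compmA lact1 lunit_nat.
Qed.

Lemma mod_cokernel (X Y : lmodule A) (f : mod_hom X Y) (Q : C)
    (p : mor (mcar Y) Q) : is_cokernel (mod_hom_val f) p ->
  is_coequalizer (acar A ◃ mod_hom_val f) (acar A ◃ 0) (acar A ◃ p) ->
  epi (acar A ◃ (acar A ◃ p)) ->
  exists (a : mor (A ⊗ Q) Q) (aP : is_action a),
    p ∘ lact Y = a ∘ (acar A ◃ p).
Proof.
move=> [pf up] coAp epiAAp; have epi_p : epi p by apply: cokernel_epi (conj pf up).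
have [|a [ap _]] := coAp.2 _ (p ∘ lact Y).
  by rewrite -!compmA tensm0 -mod_hom_lact !compm0 compmA pf comp0m.
have aP : is_action a; last by exists a, aP.
apply/actionE; split.
  apply: epiAAp; rewrite (at2 (ext_nat _ _)) compmA ap (at2 (lactM _)).
  rewrite -[RHS]compmA -whiskerlD ap.
  by rewrite whiskerlD !compmA ap.
apply: (epi_whiskerl_unit epi_p).
by rewrite (at2 (whisker_swap _ _ _)) compmA ap (at2 (lact1 _)) lunit_nat.
Qed.

Lemma is_kernel_mod (N X Y : lmodule A) (f : mod_hom X Y) (i : mod_hom N X) :
  is_kernel (mod_hom_val f) (mod_hom_val i) ->
  @is_kernel k (mod_cat A) N X Y f i.
Proof.
move=> ker_i; have [fi up] := ker_i; split; first exact: mod_hom_inj.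
move=> Z g fg; have [|h [ih uh]] := up _ (mod_hom_val g).
  exact: (congr1 (fun u => mod_hom_val u) fg).
have hP : h ∘ lact Z = lact N ∘ (acar A ◃ h).
  apply: (kernel_mono ker_i); rewrite !compmA mod_hom_lact ih mod_hom_lact.
  by rewrite -[RHS]compmA -whiskerlD ih.
exists (mkmod_hom hP); split; first exact: mod_hom_inj.
move=> h' ih'; apply: mod_hom_inj; apply: uh.
exact: (congr1 (fun u => mod_hom_val u) ih').
Qed.

Lemma is_cokernel_mod (X Y Q : lmodule A) (f : mod_hom X Y) (p : mod_hom Y Q) :
  is_cokernel (mod_hom_val f) (mod_hom_val p) ->
  epi (acar A ◃ mod_hom_val p) ->
  @is_cokernel k (mod_cat A) X Y Q f p.
Proof.
move=> [pf up] epiAp; split; first exact: mod_hom_inj.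
move=> Z g fg; have [|h [hp uh]] := up _ (mod_hom_val g).
  exact: (congr1 (fun u => mod_hom_val u) fg).
have hP : h ∘ lact Q = lact Z ∘ (acar A ◃ h).
  apply: epiAp; rewrite -compmA -mod_hom_lact compmA hp mod_hom_lact.
  by rewrite -[RHS]compmA -whiskerlD hp.
exists (mkmod_hom hP); split; first exact: mod_hom_inj.
move=> h' hp'; apply: mod_hom_inj; apply: uh.
exact: (congr1 (fun u => mod_hom_val u) hp').
Qed.

End Modules.

(** The inverse of an equivariant isomorphism is equivariant. *)
Lemma mod_iso (k : fieldType) (C : lincat k) (I : C) (M : monoidal I)
    (A : algebra M) (X Y : lmodule A) (f : mod_hom X Y) :
  is_iso (mod_hom_val f) -> @is_iso k (mod_cat A) X Y f.
Proof.
move=> [g [gf fg]].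
have gP : g ∘ lact Y = lact X ∘ (acar A ◃[M] g).
  rewrite -[LHS]comp_idr -(tensm_id M A Y) -fg whiskerlD.
  by rewrite -!compmA (compmA (lact Y)) -mod_hom_lact !compmA gf comp_idl.
by exists (mkmod_hom gP); split; apply: mod_hom_inj.
Qed.

(** * Modules form an abelian category *)

Section ModulesAbelian.
Variables (k : fieldType) (C : lincat k) (I : C) (M : monoidal I).
Variable A : algebra M.
Hypothesis abC : is_abelian C.
Hypothesis coeqA : forall (X Y Q : C) (f g : mor X Y) (p : mor Y Q),
  is_coequalizer f g p ->
  is_coequalizer (acar A ◃[M] f) (acar A ◃[M] g) (acar A ◃[M] p).

Lemma mod_kernel_ex (X Y : lmodule A) (f : mod_hom X Y) :
  exists (N : lmodule A) (i : mod_hom N X),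
    is_kernel (mod_hom_val f) (mod_hom_val i).
Proof.
have [N [i ker_i]] := abelian_kernel abC (mod_hom_val f).
have [a [aP ia]] := mod_kernel ker_i.
by exists (LModule aP), (@mkmod_hom _ _ _ _ _ (LModule aP) X i ia).
Qed.

Lemma mod_cokernel_ex (X Y : lmodule A) (f : mod_hom X Y) :
  exists (Q : lmodule A) (p : mod_hom Y Q),
    is_cokernel (mod_hom_val f) (mod_hom_val p) /\
    epi (acar A ◃[M] mod_hom_val p).
Proof.
have [Q [p cok_p]] := abelian_cokernel abC (mod_hom_val f).
have coAp := coeqA ((cokernel_coequalizer _ _).1 cok_p).
have coAAp := coeqA coAp.
have [a [aP pa]] := mod_cokernel cok_p coAp (coequalizer_epi coAAp).
exists (LModule aP), (@mkmod_hom _ _ _ _ _ Y (LModule aP) p pa); split=> //.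
exact: coequalizer_epi coAp.
Qed.

(** Kernels and cokernels of modules are those of [C].  Hence a monomorphism of
    modules is one in [C], where it is the kernel of its cokernel, and dually. *)
Lemma mod_cat_abelian : is_abelian (mod_cat A).
Proof.
split.
- by have [Z /(mod_zero_object A)] := abelian_zero abC.
- by move=> X Y; apply/mod_biproduct/(abelian_biproduct abC).
- move=> X Y f; have [N [i ker_i]] := mod_kernel_ex f.
  by exists N, i; apply: is_kernel_mod.
- move=> X Y f; have [Q [p [cok_p epiAp]]] := mod_cokernel_ex f.
  by exists Q, p; apply: is_cokernel_mod.
- move=> X Y f mono_f.
  have mono_vf : mono (mod_hom_val f).
    have [N [i ker_i]] := mod_kernel_ex f.
    have [fi up] := ker_i.
    have i0 : i = 0.
      apply: (mono_f N i 0); rewrite compm0; exact: mod_hom_inj.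
    apply: mono_zero => Z g fg; have [h [<- _]] := up _ _ fg.
    by rewrite i0 comp0m.
  have [Z [g ker_f]] := abelian_mono abC mono_vf.
  have [Q [p [cok_p _]]] := mod_cokernel_ex f.
  by exists Q, p; apply: is_kernel_mod; apply: kernel_of_cokernel ker_f cok_p.
move=> X Y f epi_f.
have epi_vf : epi (mod_hom_val f).
  have [Q [p [[pf up] _]]] := mod_cokernel_ex f.
  have p0 : p = 0.
    apply: (epi_f Q p 0); rewrite comp0m; exact: mod_hom_inj.
  apply: epi_zero => Z g gf; have [h [<- _]] := up _ _ gf.
  by rewrite p0 compm0.
have [Z [g cok_f]] := abelian_epi abC epi_vf.
have [N [i ker_i]] := mod_kernel_ex f.
exists N, i; have cok_if := cokernel_of_kernel cok_f ker_i.
apply: is_cokernel_mod => //.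
exact: coequalizer_epi (coeqA ((cokernel_coequalizer _ _).1 cok_if)).
Qed.

End ModulesAbelian.

(** * The tensor product over the algebra *)

Section Bilinear.
Variables (k : fieldType) (C : lincat k) (I : C) (M : monoidal I).
Variables (c : braiding M) (A : algebra M).

Local Notation "X ⊗ Y" := (tens M X Y) (at level 39, left associativity).
Local Notation "f ▹ Z" := (tensm M f (idm Z)) (at level 39, left associativity).
Local Notation "X ◃ f" := (tensm M (idm X) f) (at level 39, left associativity).
Local Notation ass := (assoc M).
Local Notation asi := (associ M).
Local Notation brx := (brx c).
Local Notation slide := (slide c).

(** The right action of [A] on [X] comes from the left one by the inverse
    braiding.  Moving that braiding to the other side of the equation turns the
    usual condition on [h] into one with two left actions. *)
Definition A_balanced (X Y : lmodule A) (W : C)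
    (h : mor (mcar X ⊗ mcar Y) W) : Prop :=
  h ∘ ext (lact X) Y = h ∘ slide (lact Y) X.

Definition A_bilinear (X Y W : lmodule A)
    (h : mor (mcar X ⊗ mcar Y) (mcar W)) : Prop :=
  h ∘ ext (lact X) Y = lact W ∘ (acar A ◃ h) /\
  h ∘ slide (lact Y) X = lact W ∘ (acar A ◃ h).

Definition A_trilinear (X Y Z W : lmodule A)
    (h : mor (mcar X ⊗ (mcar Y ⊗ mcar Z)) (mcar W)) : Prop :=
  [/\ h ∘ ext (lact X) (Y ⊗ Z) = lact W ∘ (acar A ◃ h),
      h ∘ slide (ext (lact Y) Z) X = lact W ∘ (acar A ◃ h)
    & h ∘ slide (slide (lact Z) Y) X = lact W ∘ (acar A ◃ h)].

Lemma balanced_coequalizer (X Y : lmodule A) (Q : C) (p : mor (X ⊗ Y) Q) :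
  is_coequalizer (lact X ▹ Y)
    ((mcar X ◃ lact Y) ∘ ass X A Y ∘ (c A X ▹ Y)) p <->
  is_coequalizer (ext (lact X) Y) (slide (lact Y) X) p.
Proof.
rewrite -slide_assoc -(ext_assoc Y (lact X)); symmetry.
exact/coequalizer_pre/iso_epi/assoc_iso.
Qed.

Lemma tensm_ext (X X' Y Y' : lmodule A) (f : mod_hom X X') (g : mod_hom Y Y') :
  (mod_hom_val f ⊠[M] mod_hom_val g) ∘ ext (lact X) Y =
  ext (lact X') Y' ∘ (acar A ◃ (mod_hom_val f ⊠[M] mod_hom_val g)).
Proof.
rewrite tensmE -compmA -ext_nat compmA -ext_post mod_hom_lact ext_prer.
by rewrite -compmA -!whiskerlD.
Qed.

Lemma tensm_slide (X X' Y Y' : lmodule A) (f : mod_hom X X')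
    (g : mod_hom Y Y') :
  (mod_hom_val f ⊠[M] mod_hom_val g) ∘ slide (lact Y) X =
  slide (lact Y') X' ∘ (acar A ◃ (mod_hom_val f ⊠[M] mod_hom_val g)).
Proof.
rewrite tensmE -compmA -slide_post mod_hom_lact slide_prer compmA -slide_nat.
by rewrite -compmA -!whiskerlD.
Qed.

Hypothesis commA : commutative_algebra c A.

Lemma lact_bilinear (X : lmodule A) :
  @A_bilinear (regular_mod A) X X (lact X).
Proof.
split; first exact: lactM.
by rewrite slideE compmA -lactM -compmA ext_amul_comm.
Qed.

Lemma ract_ex (X : lmodule A) :
  exists r : mor (X ⊗ A) X, r ∘ c A X == lact X.
Proof.
have [b [bK _]] := br_iso c A X; exists (lact X ∘ b).
by rewrite -compmA bK comp_idr.
Qed.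

Definition ract (X : lmodule A) : mor (X ⊗ A) X := xchoose (ract_ex X).

Lemma ract_br (X : lmodule A) : ract X ∘ c A X = lact X.
Proof. exact/eqP/(xchooseP (ract_ex X)). Qed.

(** Pull the crossing of [A] and [X] through the action, respectively through the
    multiplication; what is left is an axiom of the left action, up to a
    braiding of [A] with itself that commutativity absorbs. *)
Lemma ract_bilinear (X : lmodule A) :
  @A_bilinear X (regular_mod A) X (ract X).
Proof.
have epi_Ac : epi (acar A ◃ c A X) by apply/iso_epi/is_iso_whiskerl/br_iso.
split; apply: epi_Ac; rewrite -[RHS]compmA -whiskerlD ract_br.
  apply: (iso_epi (brx_iso c A A X)).
  rewrite (at3 (esym (br_extr _ _ _))) compmA ract_br -lactM.
  by rewrite -compmA ext_amul_comm.
by rewrite slideE -!compmA (compmA (mcar X ◃ _)) -br_extl compmA ract_br lactM.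
Qed.

Lemma ract_one (X : lmodule A) : ract X ∘ (mcar X ◃ aone A) = runit M X.
Proof.
apply: (iso_epi (br_iso c I X)).
by rewrite -compmA -br_natl compmA ract_br lact1 br_unit.
Qed.

(** The usual form of balancedness, with a right action in the middle. *)
Lemma balanced_ract (X Y : lmodule A) (W : C) (h : mor (X ⊗ Y) W) :
  A_balanced h -> h ∘ (ract X ▹ Y) = h ∘ (mcar X ◃ lact Y) ∘ ass X A Y.
Proof.
move=> bal; apply: (iso_epi (is_iso_whiskerr M Y (br_iso c A X))).
rewrite -compmA -whiskerrD ract_br -(ext_assoc Y (lact X)) compmA bal.
by rewrite -compmA slide_assoc !compmA.
Qed.

End Bilinear.

Section RelativeTensor.
Variables (k : fieldType) (C : lincat k) (I : C) (M : monoidal I).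
Variables (c : braiding M) (A : algebra M).

Local Notation "X ⊗ Y" := (tens M X Y) (at level 39, left associativity).
Local Notation "f ▹ Z" := (tensm M f (idm Z)) (at level 39, left associativity).
Local Notation "X ◃ f" := (tensm M (idm X) f) (at level 39, left associativity).
Local Notation ass := (assoc M).
Local Notation asi := (associ M).
Local Notation brx := (brx c).
Local Notation slide := (slide c).
Local Notation A_bilinear := (A_bilinear c).
Local Notation A_trilinear := (A_trilinear c).
Local Notation ract := (ract c).
Local Notation A1 := (regular_mod A : lmodule A).

Hypothesis commA : commutative_algebra c A.
Hypothesis coeql : forall (X Y Q Z : C) (f g : mor X Y) (p : mor Y Q),
  is_coequalizer f g p -> is_coequalizer (Z ◃ f) (Z ◃ g) (Z ◃ p).
Hypothesis coeqr : forall (X Y Q Z : C) (f g : mor X Y) (p : mor Y Q),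
  is_coequalizer f g p -> is_coequalizer (f ▹ Z) (g ▹ Z) (p ▹ Z).

(** The two actions of [A] on [X ⊗ Y] commute by [slide_ext_comm]. *)
Lemma tensor_over_ex (abC : is_abelian C) (X Y : lmodule A) :
  exists (Q : lmodule A) (p : mor (X ⊗ Y) Q),
    is_coequalizer (ext (lact X) Y) (slide (lact Y) X) p /\
    lact Q ∘ (acar A ◃ p) = p ∘ ext (lact X) Y.
Proof.
have [Q [p /coequalizer_cokernel coq]] :=
  abelian_cokernel abC (ext (lact X) Y - slide (lact Y) X).
have coAq := coeql A coq; have coAAq := coeql A coAq.
have [d dP dp] := coequalizer_action commA (ext_action Y (actP X))
  (slide_ext_comm _ _ _) coq coAq (coequalizer_epi coAAq).
by exists (LModule dP), p.
Qed.

Variable tn : lmodule A -> lmodule A -> lmodule A.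
Variable pi : forall X Y : lmodule A, mor (X ⊗ Y) (tn X Y).
Hypothesis pi_coeq : forall X Y : lmodule A,
  is_coequalizer (ext (lact X) Y) (slide (lact Y) X) (pi X Y).
Hypothesis pi_act : forall X Y : lmodule A,
  lact (tn X Y) ∘ (acar A ◃ pi X Y) = pi X Y ∘ ext (lact X) Y.

Lemma pi_epi (X Y : lmodule A) : epi (pi X Y).
Proof. exact: coequalizer_epi (pi_coeq X Y). Qed.

Lemma pi_epil (X Y : lmodule A) (Z : C) : epi (Z ◃ pi X Y).
Proof. exact: coequalizer_epi (coeql Z (pi_coeq X Y)). Qed.

Lemma pi_epir (X Y : lmodule A) (Z : C) : epi (pi X Y ▹ Z).
Proof. exact: coequalizer_epi (coeqr Z (pi_coeq X Y)). Qed.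

Lemma pi_balanced (X Y : lmodule A) : A_balanced c (pi X Y).
Proof. exact: (pi_coeq X Y).1. Qed.

(** A bilinear morphism is balanced, and its factorization is equivariant since
    [A ◃ pi X Y] is an epimorphism. *)
Lemma bilinear_factor (X Y W : lmodule A) (h : mor (X ⊗ Y) W) :
  A_bilinear h -> exists t : mod_hom (tn X Y) W, mod_hom_val t ∘ pi X Y = h.
Proof.
move=> [h1 h2]; have [t [tE _]] := (pi_coeq X Y).2 _ h (etrans h1 (esym h2)).
have tP : t ∘ lact (tn X Y) = lact W ∘ (acar A ◃ t).
  apply: (pi_epil (Z := A)); rewrite -compmA pi_act compmA tE h1.
  by rewrite -[RHS]compmA -whiskerlD tE.
by exists (mkmod_hom tP).
Qed.

Lemma mod_hom_pi_inj (X Y W : lmodule A) (t u : mod_hom (tn X Y) W) :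
  mod_hom_val t ∘ pi X Y = mod_hom_val u ∘ pi X Y -> t = u.
Proof. by move=> e; apply/mod_hom_inj/pi_epi. Qed.

Lemma bilinear_tensm (X X' Y Y' : lmodule A) (f : mod_hom X X')
    (g : mod_hom Y Y') :
  A_bilinear (pi X' Y' ∘ (mod_hom_val f ⊠[M] mod_hom_val g)).
Proof.
split; rewrite -compmA ?tensm_ext ?tensm_slide compmA.
  by rewrite -pi_act -compmA -whiskerlD.
by rewrite -pi_balanced -pi_act -compmA -whiskerlD.
Qed.

(** The two iterated projections are taken on the same product in [C], in order
    to compare them as trilinear maps. *)
Definition tril (X Y Z : lmodule A) : mor (X ⊗ (Y ⊗ Z)) (tn (tn X Y) Z) :=
  pi (tn X Y) Z ∘ (pi X Y ▹ Z) ∘ asi X Y Z.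

Definition trir (X Y Z : lmodule A) : mor (X ⊗ (Y ⊗ Z)) (tn X (tn Y Z)) :=
  pi X (tn Y Z) ∘ (mcar X ◃ pi Y Z).

Lemma tril_trilinear (X Y Z : lmodule A) : A_trilinear (tril X Y Z).
Proof.
have e : tril X Y Z ∘ ext (lact X) (Y ⊗ Z) =
    lact (tn (tn X Y) Z) ∘ (acar A ◃ tril X Y Z).
  rewrite !whiskerlD !compmA pi_act -(compmA _ (ext _ _)) -ext_prer pi_act.
  rewrite ext_post ext_ext -!compmA -whiskerlD associK tensm_id.
  by rewrite comp_idr.
split=> //.
  have epi_as : epi (acar A ◃ ass X Y Z).
    by apply/iso_epi/is_iso_whiskerl/assoc_iso.
  rewrite -e; apply: epi_as.
  rewrite (at2 (esym (ext_slide _ _ _ _))) (at3 (esym (ext_ext _ _ _))) !compmA.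
  rewrite (at2 (assocK _ _ _ _)) comp_idr !(at2 (esym (ext_post _ _ _))).
  by rewrite pi_balanced.
rewrite (at2 (esym (slide_tens _ _ _ _))) !compmA (at2 (esym (slide_nat _ _ _))).
by rewrite !whiskerlD !compmA pi_act pi_balanced.
Qed.

Lemma trir_trilinear (X Y Z : lmodule A) : A_trilinear (trir X Y Z).
Proof.
have e : trir X Y Z ∘ ext (lact X) (Y ⊗ Z) =
    lact (tn X (tn Y Z)) ∘ (acar A ◃ trir X Y Z).
  rewrite whiskerlD !compmA pi_act -!compmA.
  by rewrite ext_nat.
split; rewrite // -e.
  rewrite -!compmA -slide_post -pi_act slide_prer -ext_nat !compmA.
  by rewrite pi_balanced.
rewrite -!compmA -slide_post -pi_balanced -pi_act slide_prer -ext_nat !compmA.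
by rewrite pi_balanced.
Qed.

Lemma trir_epi (X Y Z : lmodule A) : epi (trir X Y Z).
Proof. exact/epi_comp/pi_epil/pi_epi. Qed.

Lemma tril_epi (X Y Z : lmodule A) : epi (tril X Y Z).
Proof.
apply: epi_comp; last exact/iso_epi/associ_iso.
exact/epi_comp/pi_epir/pi_epi.
Qed.

(** Trilinearity contains balancedness in [Y] and [Z], which factors [h] through
    [X ◃ pi Y Z]; the rest says that the quotient is bilinear. *)
Lemma trir_factor (X Y Z W : lmodule A) (h : mor (X ⊗ (Y ⊗ Z)) W) :
  A_trilinear h -> exists t : mod_hom (tn X (tn Y Z)) W,
    mod_hom_val t ∘ trir X Y Z = h.
Proof.
move=> [h1 h2 h3].
have [|g [gE _]] := (coeql X (pi_coeq Y Z)).2 _ h.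
  apply: (iso_epi (brx_iso c A X (Y ⊗ Z))).
  by rewrite -!compmA -!slideE h2 h3.
have [|t tE] := @bilinear_factor X (tn Y Z) W g; last first.
  by exists t; rewrite compmA tE.
split; apply: (@coequalizer_epi _ _ _ _ _ _ _ _
   (coeql A (coeql X (pi_coeq Y Z)))).
  rewrite -[RHS]compmA -whiskerlD gE -h1 -compmA ext_nat compmA.
  by rewrite gE.
rewrite -[RHS]compmA -whiskerlD gE -compmA -slide_prer pi_act slide_post.
by rewrite compmA gE h2.
Qed.

(** Symmetrically, balancedness in [X] and [Y] factors [h] through
    [pi X Y ▹ Z]. *)
Lemma tril_factor (X Y Z W : lmodule A) (h : mor (X ⊗ (Y ⊗ Z)) W) :
  A_trilinear h -> exists t : mod_hom (tn (tn X Y) Z) W,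
    mod_hom_val t ∘ tril X Y Z = h.
Proof.
move=> [h1 h2 h3].
have extE1 : h ∘ ass X Y Z ∘ ext (ext (lact X) Y) Z =
    lact W ∘ (acar A ◃ (h ∘ ass X Y Z)).
  rewrite ext_ext !compmA (at2 (associK _ _ _ _)) comp_idr h1.
  by rewrite -compmA -whiskerlD.
have extE2 : h ∘ ass X Y Z ∘ ext (slide (lact Y) X) Z =
    lact W ∘ (acar A ◃ (h ∘ ass X Y Z)).
  by rewrite (at2 (ext_slide _ _ _ _)) compmA h2 -compmA -whiskerlD.
have [|g [gE _]] := (coeqr Z (pi_coeq X Y)).2 _ (h ∘ ass X Y Z).
  apply: (iso_epi (associ_iso M A (X ⊗ Y) Z)).
  by rewrite -!compmA -!extE !compmA extE1 extE2.
have [|t tE] := @bilinear_factor (tn X Y) Z W g; last first.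
  by exists t; rewrite !compmA tE gE (at2 (associK _ _ _ _)) comp_idr.
split; apply: (@coequalizer_epi _ _ _ _ _ _ _ _
   (coeql A (coeqr Z (pi_coeq X Y)))).
  rewrite -[RHS]compmA -whiskerlD gE -extE1 -compmA -ext_prer pi_act ext_post.
  by rewrite compmA gE.
rewrite -[RHS]compmA -whiskerlD gE -compmA slide_nat compmA gE.
apply: (iso_epi (is_iso_whiskerl M A (associ_iso M X Y Z))).
rewrite -compmA slide_tens !compmA (at2 (associK _ _ _ _)) comp_idr h3.
rewrite -[RHS]compmA -whiskerlD.
by rewrite (at2 (associK _ _ _ _)) comp_idr.
Qed.

Definition bilift (X Y W : lmodule A) (h : mor (X ⊗ Y) W)
    (hP : A_bilinear h) : mod_hom (tn X Y) W :=
  sval (constructive_indefinite_description _ (bilinear_factor hP)).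

Lemma biliftE (X Y W : lmodule A) (h : mor (X ⊗ Y) W) (hP : A_bilinear h) :
  mod_hom_val (bilift hP) ∘ pi X Y = h.
Proof. by rewrite /bilift; case: constructive_indefinite_description. Qed.

Definition tens_mod (X X' Y Y' : lmodule A) (f : mod_hom X X')
    (g : mod_hom Y Y') : mod_hom (tn X Y) (tn X' Y') :=
  bilift (bilinear_tensm f g).

Definition assoc_mod (X Y Z : lmodule A) :
    mod_hom (tn (tn X Y) Z) (tn X (tn Y Z)) :=
  sval (constructive_indefinite_description _
    (tril_factor (trir_trilinear X Y Z))).

Definition associ_mod (X Y Z : lmodule A) :
    mod_hom (tn X (tn Y Z)) (tn (tn X Y) Z) :=
  sval (constructive_indefinite_description _
    (trir_factor (tril_trilinear X Y Z))).

Definition lunit_mod (X : lmodule A) : mod_hom (tn A1 X) X :=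
  bilift (lact_bilinear commA X).

Definition runit_mod (X : lmodule A) : mod_hom (tn X A1) X :=
  bilift (ract_bilinear commA X).

Lemma tens_modE (X X' Y Y' : lmodule A) (f : mod_hom X X')
    (g : mod_hom Y Y') :
  mod_hom_val (tens_mod f g) ∘ pi X Y =
  pi X' Y' ∘ (mod_hom_val f ⊠[M] mod_hom_val g).
Proof. exact: biliftE. Qed.

Lemma assoc_modE (X Y Z : lmodule A) :
  mod_hom_val (assoc_mod X Y Z) ∘ pi (tn X Y) Z ∘ (pi X Y ▹ Z) =
  pi X (tn Y Z) ∘ (mcar X ◃ pi Y Z) ∘ ass X Y Z.
Proof.
apply: (iso_epi (associ_iso M X Y Z)).
rewrite (at2 (associK _ _ _ _)) comp_idr -!compmA (compmA (pi _ _)).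
rewrite -/(trir X Y Z) -/(tril X Y Z).
by rewrite /assoc_mod; case: constructive_indefinite_description.
Qed.

Lemma associ_modE (X Y Z : lmodule A) :
  mod_hom_val (associ_mod X Y Z) ∘ trir X Y Z = tril X Y Z.
Proof.
by rewrite /associ_mod; case: constructive_indefinite_description.
Qed.

Lemma assoc_modE' (X Y Z : lmodule A) :
  mod_hom_val (assoc_mod X Y Z) ∘ tril X Y Z = trir X Y Z.
Proof.
by rewrite !compmA assoc_modE (at2 (associK _ _ _ _)) comp_idr.
Qed.

Lemma lunit_modE (X : lmodule A) :
  mod_hom_val (lunit_mod X) ∘ pi A1 X = lact X.
Proof. exact: biliftE. Qed.

Lemma runit_modE (X : lmodule A) :
  mod_hom_val (runit_mod X) ∘ pi X A1 = ract X.
Proof. exact: biliftE. Qed.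

Lemma mod_compE (X Y Z : lmodule A) (g : mod_hom Y Z) (f : mod_hom X Y) :
  mod_hom_val (mod_comp g f) = mod_hom_val g ∘ mod_hom_val f.
Proof. by []. Qed.

Lemma mod_idmE (X : lmodule A) : mod_hom_val (mod_idm X) = idm (mcar X).
Proof. by []. Qed.

Lemma pi_ract (X Y : lmodule A) :
  pi X Y ∘ (ract X ▹ Y) = pi X Y ∘ (mcar X ◃ lact Y) ∘ ass X A Y.
Proof. exact/balanced_ract/pi_balanced. Qed.

(** The inverse inserts the unit of [A]: in [A ⊗_A X], acting on the second factor
    of [1 ⊗ x] is the same as acting on the first. *)
Lemma lunit_mod_iso (X : lmodule A) : is_iso (mod_hom_val (lunit_mod X)).
Proof.
have [l [lK Kl]] := lunit_iso M X.
exists (pi A1 X ∘ (aone A ▹ X) ∘ l); split; last first.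
  by rewrite !compmA lunit_modE lact1 Kl.
apply: (@pi_epi A1 X); rewrite -compmA lunit_modE comp_idl.
apply: (iso_epi (lunit_iso M (A ⊗ X))).
rewrite (at2 (esym (lunit_nat _ _))) compmA (at2 lK) comp_idr.
rewrite (at2 (whisker_swap _ _ _)) compmA.
have -> : pi A1 X ∘ (acar A ◃ lact X) = pi A1 X ∘ ext (amul A) X.
  apply: (iso_epi (brx_iso c A A X)).
  rewrite -!compmA -slideE ext_amul_comm //.
  exact/esym/(pi_balanced A1 X).
by rewrite -compmA -ext_prel amul1l ext_lunit.
Qed.

Lemma runit_mod_iso (X : lmodule A) : is_iso (mod_hom_val (runit_mod X)).
Proof.
have [r [rK Kr]] := runit_iso M X.
exists (pi X A1 ∘ (mcar X ◃ aone A) ∘ r); split; last first.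
  by rewrite !compmA runit_modE ract_one Kr.
apply: (@pi_epi X A1); rewrite -compmA runit_modE comp_idl.
apply: (iso_epi (runit_iso M (X ⊗ A))).
rewrite (at2 (esym (runit_nat _ _))) compmA (at2 rK) comp_idr.
rewrite (at2 (esym (whisker_swap _ _ _))) compmA pi_ract /=.
rewrite -(tensm_id M X A) (at2 (assoc_nat _ _ _ _)) compmA.
by rewrite (at2 (esym (whiskerlD _ _ _ _))) amul1r (at2 (runit_tens _ _ _)).
Qed.

Lemma triangle_mod (X Y : lmodule A) :
  mod_comp (tens_mod (mod_idm X) (lunit_mod Y)) (assoc_mod X A1 Y) =
  tens_mod (runit_mod X) (mod_idm Y).
Proof.
apply/mod_hom_pi_inj/(pi_epir (Z := mcar Y)).
rewrite !mod_compE.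
rewrite (at3 (assoc_modE _ _ _)) !compmA !tens_modE ?mod_idmE.
rewrite -!(compmA (pi X Y)) -whiskerlD -whiskerrD.
by rewrite lunit_modE runit_modE pi_ract compmA.
Qed.

Lemma assoc_mod_nat (X X' Y Y' Z Z' : lmodule A)
    (f : mod_hom X X') (g : mod_hom Y Y') (h : mod_hom Z Z') :
  mod_comp (assoc_mod X' Y' Z') (tens_mod (tens_mod f g) h) =
  mod_comp (tens_mod f (tens_mod g h)) (assoc_mod X Y Z).
Proof.
apply/mod_hom_pi_inj/(pi_epir (Z := mcar Z)).
rewrite !mod_compE.
rewrite (at3 (assoc_modE _ _ _)) !compmA tens_modE (at2 (tens_modE _ _)).
rewrite !compmA.
rewrite (at2 (esym (tensm_comp _ _ _ _ _))) tens_modE comp_idr.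
rewrite -(comp_idl (mod_hom_val h)) tensm_comp !compmA assoc_modE.
rewrite (at2 (assoc_nat _ _ _ _)) !compmA; congr (_ ∘ _).
rewrite -!(compmA (pi X' (tn Y' Z'))) -!tensm_comp comp_idl comp_idr.
by rewrite tens_modE.
Qed.

(** Both sides are determined by their composites with the iterated projection
    from the product of the four modules in [C], and those agree by the
    pentagon of [C]. *)
Lemma pentagon_mod (W X Y Z : lmodule A) :
  mod_comp (assoc_mod W X (tn Y Z)) (assoc_mod (tn W X) Y Z) =
  mod_comp (mod_comp (tens_mod (mod_idm W) (assoc_mod X Y Z))
    (assoc_mod W (tn X Y) Z)) (tens_mod (assoc_mod W X Y) (mod_idm Z)).
Proof.
apply/mod_hom_pi_inj/(pi_epir (Z := mcar Z)).
rewrite !mod_compE.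
apply: (@coequalizer_epi _ _ _ _ _ _ _ _ (coeqr Z (coeqr Y (pi_coeq W X)))).
rewrite (at3 (assoc_modE _ _ _)) !compmA (at2 (assoc_nat _ _ _ _)) !compmA.
rewrite tensm_id (at2 (esym (whisker_swap _ _ _))) !compmA assoc_modE.
rewrite -(tensm_id M W X) (at2 (assoc_nat _ _ _ _)) !compmA.
rewrite [in RHS](at2 (tens_modE _ _)) ?mod_idmE !compmA.
have e := congr1 (fun f => f ▹ Z) (assoc_modE W X Y).
rewrite /= !whiskerrD in e.
rewrite (at3 e) !compmA (at3 (assoc_modE _ _ _)) !compmA tens_modE ?mod_idmE.
rewrite (at2 (assoc_nat _ _ _ _)) !compmA.
have e' := congr1 (fun f => mcar W ◃ f) (assoc_modE X Y Z).
rewrite /= !whiskerlD in e'.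
by rewrite (at3 e') !compmA -[LHS]compmA pentagon !compmA.
Qed.

Lemma tens_mod_id (X Y : lmodule A) :
  tens_mod (mod_idm X) (mod_idm Y) = mod_idm (tn X Y).
Proof.
by apply: mod_hom_pi_inj; rewrite tens_modE !mod_idmE tensm_id comp_idl comp_idr.
Qed.

Lemma tens_mod_comp (X X' X'' Y Y' Y'' : lmodule A) (f' : mod_hom X' X'')
    (f : mod_hom X X') (g' : mod_hom Y' Y'') (g : mod_hom Y Y') :
  tens_mod (mod_comp f' f) (mod_comp g' g) =
  mod_comp (tens_mod f' g') (tens_mod f g).
Proof.
apply: mod_hom_pi_inj; rewrite tens_modE !mod_compE tensm_comp.
by rewrite (at2 (tens_modE _ _)) !compmA tens_modE.
Qed.

Lemma tens_mod_linl (X X' Y Y' : lmodule A) (a : k) (f f' : mod_hom X X')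
    (g : mod_hom Y Y') :
  tens_mod (a *: f + f') g = a *: tens_mod f g + tens_mod f' g.
Proof.
apply: mod_hom_pi_inj; rewrite tens_modE.
rewrite [mod_hom_val (_ + _)]/(_ + _) /= tensm_linl comp_linr.
by rewrite comp_linl !tens_modE.
Qed.

Lemma tens_mod_linr (X X' Y Y' : lmodule A) (a : k) (f : mod_hom X X')
    (g g' : mod_hom Y Y') :
  tens_mod f (a *: g + g') = a *: tens_mod f g + tens_mod f g'.
Proof.
apply: mod_hom_pi_inj; rewrite tens_modE.
rewrite [mod_hom_val (_ + _)]/(_ + _) /= tensm_linr comp_linr.
by rewrite comp_linl !tens_modE.
Qed.

Lemma assoc_mod_inv (X Y Z : lmodule A) :
  @inverse_of k (mod_cat A) _ _ (assoc_mod X Y Z) (associ_mod X Y Z).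
Proof.
split; apply: mod_hom_inj; rewrite mod_compE mod_idmE.
  by apply: (@tril_epi X Y Z); rewrite -compmA assoc_modE' associ_modE comp_idl.
by apply: (@trir_epi X Y Z); rewrite -compmA associ_modE assoc_modE' comp_idl.
Qed.

Lemma lunit_mod_nat (X Y : lmodule A) (f : mod_hom X Y) :
  mod_comp (lunit_mod Y) (tens_mod (mod_idm A1) f) = mod_comp f (lunit_mod X).
Proof.
apply: mod_hom_pi_inj; rewrite !mod_compE (at2 (tens_modE _ _)) compmA.
by rewrite (at2 (lunit_modE _)) lunit_modE mod_hom_lact.
Qed.

Lemma ract_nat (X Y : lmodule A) (f : mod_hom X Y) :
  ract Y ∘ (mod_hom_val f ▹ A) = mod_hom_val f ∘ ract X.
Proof.
apply: (iso_epi (br_iso c A X)).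
by rewrite -!compmA -br_natr compmA !ract_br mod_hom_lact.
Qed.

Lemma runit_mod_nat (X Y : lmodule A) (f : mod_hom X Y) :
  mod_comp (runit_mod Y) (tens_mod f (mod_idm A1)) = mod_comp f (runit_mod X).
Proof.
apply: mod_hom_pi_inj; rewrite !mod_compE (at2 (tens_modE _ _)) compmA.
by rewrite (at2 (runit_modE _)) runit_modE -ract_nat.
Qed.

Definition tensor_over_monoidal : monoidal (regular_mod A) :=
  @Monoidal k (mod_cat A) (regular_mod A) tn tens_mod assoc_mod associ_mod
    lunit_mod runit_mod tens_mod_id tens_mod_comp tens_mod_linl tens_mod_linr
    assoc_mod_inv (fun X => mod_iso (lunit_mod_iso X))
    (fun X => mod_iso (runit_mod_iso X)) assoc_mod_nat lunit_mod_nat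
    runit_mod_nat pentagon_mod triangle_mod.

Lemma tensor_over_monoidalP : relative_monoidal c tensor_over_monoidal.
Proof.
exists pi; split=> /=.
- by move=> X Y; apply/balanced_coequalizer.
- by move=> X Y; rewrite pi_act -compmA ext_assoc.
- by move=> X X' Y Y' f g; apply: tens_modE.
- by move=> X Y Z; apply: assoc_modE.
- by move=> X; apply: lunit_modE.
- by move=> X; have := ract_br c X; rewrite -(runit_modE X).
Qed.

End RelativeTensor.

(** * Dual modules *)

Section AdjointActions.
Variables (k : fieldType) (C : lincat k) (I : C) (M : monoidal I).
Variables (c : braiding M) (A : algebra M).
Hypothesis commA : commutative_algebra c A.

Local Notation "X ⊗ Y" := (tens M X Y) (at level 39, left associativity).
Local Notation "f ▹ Z" := (tensm M f (idm Z)) (at level 39, left associativity).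
Local Notation "X ◃ f" := (tensm M (idm X) f) (at level 39, left associativity).
Local Notation brx := (brx c).
Local Notation slide := (slide c).

Variables (P X K : C) (e : mor (P ⊗ X) K).
Variables (n : mor (A ⊗ P) P) (w : mor (A ⊗ X) X).
Hypothesis adj : e ∘ ext n X = e ∘ slide w P.

(** Let [N] and [S] be the operations of [n] and [w] on [P ⊗ X], so that
    [e ∘ N = e ∘ S] and [S ∘ (A ◃ N) = N ∘ (A ◃ S) ∘ brx].  It follows that
    [e ∘ N ∘ (A ◃ N) = e ∘ S ∘ (A ◃ S) ∘ brx]: acting twice by [n] is acting
    twice by [w] with the two copies of [A] exchanged.  If one of [N] and [S]
    is an action, its side can be written with the multiplication of [A], where
    commutativity absorbs the exchange. *)
Lemma adjoint_action_left :
  (forall Y (f g : mor Y P), e ∘ (f ▹ X) = e ∘ (g ▹ X) -> f = g) ->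
  is_action w -> is_action n.
Proof.
move=> inj wP; have /actionE[SM S1] := slide_action c P wP.
have injext (Y Z : C) (f g : mor (Y ⊗ Z) P) :
    e ∘ ext f X = e ∘ ext g X -> f = g.
  by move=> h; apply: inj; rewrite -!ext_assoc !compmA h.
apply/actionE; split; apply: injext; last first.
  by rewrite ext_prel compmA adj -compmA S1 ext_lunit.
rewrite ext_post ext_prer ext_ext !compmA -(compmA e (n ▹ X)) -extE.
rewrite -[in RHS](ext_assoc X n) whiskerlD !compmA; congr (_ ∘ _).
rewrite -(ext_amul_comm commA) !compmA adj (at2 SM) compmA -adj.
by rewrite (at3 (esym (slide_ext_comm _ _ _))) compmA -adj.
Qed.

(** The relation between [n] and [w] is symmetric up to that exchange. *)
Lemma adjoint_action_right :
  (forall Y (f g : mor Y X), e ∘ (P ◃ f) = e ∘ (P ◃ g) -> f = g) ->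
  is_action n -> is_action w.
Proof.
move=> inj nP; have /actionE[NM N1] := ext_action X nP.
have injslide (Y Z : C) (f g : mor (Y ⊗ Z) X) :
    e ∘ slide f P = e ∘ slide g P -> f = g.
  move=> h; apply: inj; apply: (iso_epi (brx_iso c Y P Z)).
  by rewrite -!compmA -!slideE.
apply/actionE; split; apply: injslide; last first.
  by rewrite slide_prel compmA -adj -compmA N1 slide_lunit.
apply: (iso_epi (is_iso_whiskerl M A (brx_iso c A P X))).
rewrite -!compmA -slide_ext -slide_slide.
apply: (iso_epi (brx_iso c A A (P ⊗ X))).
rewrite -!compmA ext_amul_comm // !compmA -adj (at2 NM) compmA.
by rewrite (at3 (esym (slide_ext_comm _ _ _))) compmA -adj.
Qed.

End AdjointActions.

Section DualModules.
Variables (k : fieldType) (C : lincat k) (I : C) (M : monoidal I).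
Variables (c : braiding M) (K : C) (D : dualizing M K) (A : algebra M).
Hypothesis commA : commutative_algebra c A.

Local Notation "X ⊗ Y" := (tens M X Y) (at level 39, left associativity).
Local Notation "f ▹ Z" := (tensm M f (idm Z)) (at level 39, left associativity).
Local Notation "X ◃ f" := (tensm M (idm X) f) (at level 39, left associativity).
Local Notation ass := (assoc M).
Local Notation asi := (associ M).
Local Notation brx := (brx c).
Local Notation slide := (slide c).
Local Notation DD := (dual_ob D).
Local Notation ract := (ract c).
Local Notation A1 := (regular_mod A : lmodule A).

Lemma ev_ext_inj (Y Z X : C) (f g : mor (Y ⊗ Z) (DD X)) :
  ev D X ∘ ext f X = ev D X ∘ ext g X -> f = g.
Proof. by move=> h; apply: ev_inj; rewrite -!ext_assoc !compmA h. Qed.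

Definition dual_act (X : lmodule A) : mor (A ⊗ DD X) (DD X) :=
  transpose D (ev D X ∘ slide (lact X) (DD X) ∘ ass A (DD X) X).

Lemma dual_actE (X : lmodule A) :
  ev D X ∘ ext (dual_act X) X = ev D X ∘ slide (lact X) (DD X).
Proof.
by rewrite extE compmA transposeP (at2 (associK _ _ _ _)) comp_idr.
Qed.

(** The evaluation makes the action on [X] and the one on [DX] adjoint. *)
Lemma dual_act_is_action (X : lmodule A) : is_action (dual_act X).
Proof.
apply: (adjoint_action_left commA (dual_actE X)); last exact: actP.
exact: ev_inj.
Qed.

Definition dual_mod (X : lmodule A) : lmodule A := LModule (dual_act_is_action X).

Lemma dual_act_dual_action : is_dual_action c (dual_act A1).
Proof.
rewrite /is_dual_action transposeP -!compmA; congr (_ ∘ _).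
by rewrite slide_assoc !compmA.
Qed.

Lemma dual_action_uniq (n : mor (A ⊗ DD A) (DD A)) :
  is_dual_action c n -> dual_act A1 = n.
Proof.
move=> nP; apply: ev_inj; rewrite nP.
exact: dual_act_dual_action.
Qed.

(** Under the evaluation, acting on [DX] is acting on [X]; so after transposing,
    equivariance compares acting on [Y] with acting on [X]. *)
Lemma dual_mod_homP (X Y : lmodule A) (f : mor Y (DD X)) :
  f ∘ lact Y = lact (dual_mod X) ∘ (acar A ◃ f) <->
  A_balanced c (ev D X ∘ (f ▹ X)).
Proof.
have e : ev D X ∘ ext (dual_act X ∘ (acar A ◃ f)) X =
    ev D X ∘ (f ▹ X) ∘ slide (lact X) Y.
  by rewrite ext_prer compmA dual_actE -compmA slide_nat compmA.
rewrite /A_balanced -e -compmA -ext_post; split=> [->//|].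
exact: ev_ext_inj.
Qed.

(** Evaluation at the unit of [A] exhibits [DA] as the cofree module on [K]. *)
Lemma counit_ex : exists eps : mor (DD A) K,
  eps ∘ runit M (DD A) == ev D A ∘ (DD A ◃ aone A).
Proof.
have [r [rK _]] := runit_iso M (DD A).
by exists (ev D A ∘ (DD A ◃ aone A) ∘ r); rewrite -compmA rK comp_idr.
Qed.

Definition counit : mor (DD A) K := xchoose counit_ex.

Lemma counitE : counit ∘ runit M (DD A) = ev D A ∘ (DD A ◃ aone A).
Proof. exact/eqP/(xchooseP counit_ex). Qed.

Lemma counit_transpose (X : C) (g : mor X (DD A)) :
  counit ∘ g ∘ runit M X = ev D A ∘ (g ▹ A) ∘ (X ◃ aone A).
Proof.
rewrite -compmA -runit_nat compmA counitE.
by rewrite -!compmA whisker_swap.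
Qed.

(** Balancedness moves the argument in [A] into [X], where it acts from the right,
    and leaves the unit in its place.  So [g] can be recovered from
    [counit ∘ g]. *)
Lemma ev_mod_hom (X : lmodule A) (g : mod_hom X (dual_mod A1)) :
  ev D A ∘ (mod_hom_val g ▹ A) = counit ∘ mod_hom_val g ∘ ract X.
Proof.
have /(dual_mod_homP (X := A1)) bal := mod_hom_lact g.
apply: (iso_epi (runit_iso M (X ⊗ A))).
rewrite [in RHS](at2 (esym (runit_nat _ _))) compmA counit_transpose.
rewrite (at2 (esym (whisker_swap _ _ _))) compmA (balanced_ract bal).
rewrite -(tensm_id M X A) (at2 (assoc_nat _ _ _ _)) compmA.
rewrite (at2 (esym (whiskerlD _ _ _ _))) amul1r.
by rewrite (at2 (runit_tens _ _ _)).
Qed.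

(** The morphism to [DA] is the transpose of [x ⊗ a ↦ f (x a)]. *)
Lemma cofree (X : lmodule A) (f : mor X K) :
  exists g : mod_hom X (dual_mod A1), counit ∘ mod_hom_val g = f.
Proof.
pose g := transpose D (f ∘ ract X).
have gP : g ∘ lact X = lact (dual_mod A1) ∘ (acar A ◃ g).
  apply/(dual_mod_homP (X := A1)); rewrite transposeP.
  have [r1 r2] := ract_bilinear commA X.
  by rewrite /A_balanced -!compmA r1 -r2.
exists (@mkmod_hom _ _ _ _ _ X (dual_mod A1) g gP); apply: (iso_epi (runit_iso M X)).
by rewrite counit_transpose transposeP -compmA ract_one.
Qed.

Lemma cofree_inj (X : lmodule A) (g h : mod_hom X (dual_mod A1)) :
  counit ∘ mod_hom_val g = counit ∘ mod_hom_val h -> g = h.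
Proof.
by move=> e; apply: mod_hom_inj; apply: ev_inj; rewrite !ev_mod_hom e.
Qed.

(** Replace [Df] on the first factor with [f] on the second one under the
    evaluation, and an action on the dual with one on the module itself:
    equivariance of [Df] becomes that of [f], because the evaluation is
    nondegenerate. *)
Lemma dual_map_mod_hom (X Y : lmodule A) (f : mor X Y)
    (u : mod_hom (dual_mod Y) (dual_mod X)) :
  dual_map D f = mod_hom_val u -> f ∘ lact X = lact Y ∘ (acar A ◃ f).
Proof.
move=> uE; have := dual_map_ev D f; rewrite uE => e.
apply: (coev_inj (D := D)); apply: (iso_epi (brx_iso c A (DD Y) X)).
rewrite -!compmA -!slideE slide_post slide_prer !compmA -e -dual_actE.
rewrite -[RHS]compmA ext_nat compmA -e -[RHS]compmA.
rewrite -ext_post (mod_hom_lact u) ext_prer compmA dual_actE.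
by rewrite -!compmA slide_nat.
Qed.

(** Transport the action of [Y] to an isomorphic [DV].  The action on [V] adjoint
    to it exists since every morphism [DV → D (A ⊗ V)] is of the form [Dw]. *)
Lemma dual_mod_surj (Y : lmodule A) :
  exists (X : lmodule A) (t : mod_hom (dual_mod X) Y), is_iso (mod_hom_val t).
Proof.
have [V [t [s [st ts]]]] := dual_ob_surj D Y.
pose n := s ∘ lact Y ∘ (acar A ◃ t).
have tn : t ∘ n = lact Y ∘ (acar A ◃ t) by rewrite !compmA ts comp_idl.
have nP : is_action n.
  have mono_t : mono t by apply: iso_mono; exists s.
  apply/actionE; split; apply: mono_t; rewrite !compmA ts comp_idl.
    rewrite -compmA -ext_nat compmA lactM -[RHS]compmA -whiskerlD tn.
    by rewrite whiskerlD compmA.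
  by rewrite -compmA -whisker_swap compmA lact1 lunit_nat.
have [b [bK Kb]] := brx_iso c A (DD V) V.
have [w wE] := dual_map_surj (transpose D (ev D V ∘ ext n V ∘ b)).
have adj : ev D V ∘ ext n V = ev D V ∘ slide w (DD V).
  rewrite slideE compmA -dual_map_ev wE transposeP -[RHS]compmA bK.
  by rewrite comp_idr.
have wP : is_action w.
  by apply: (adjoint_action_right commA adj) nP => Z f g; apply: coev_inj.
have nE : dual_act (LModule wP) = n by apply: ev_ext_inj; rewrite dual_actE adj.
have tP : t ∘ lact (dual_mod (LModule wP)) = lact Y ∘ (acar A ◃ t).
  by rewrite /= nE.
by exists (LModule wP), (@mkmod_hom _ _ _ _ _ (dual_mod (LModule wP)) Y t tP), s.
Qed.

Section Dualizing.
Variable T : monoidal (regular_mod A).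
Variable pi : forall X Y : lmodule A,
  mor (mcar X ⊗ mcar Y) (mcar (X ⊗[T] Y)).
Hypothesis relT : is_relative_tensor c pi.

Lemma rel_coeq (X Y : lmodule A) :
  is_coequalizer (ext (lact X) Y) (slide (lact Y) X) (pi X Y).
Proof. exact/balanced_coequalizer/(relative_coeq relT). Qed.

Lemma rel_epi (X Y : lmodule A) : epi (pi X Y).
Proof. exact: coequalizer_epi (rel_coeq X Y). Qed.

(** The evaluation on [DX ⊗ X] is balanced, hence defined on the tensor product
    over [A]; cofreeness replaces its target [K] with [DA]. *)
Lemma evT_ex (X : lmodule A) :
  exists g : mod_hom (dual_mod X ⊗[T] X) (dual_mod A1),
    counit ∘ mod_hom_val g ∘ pi (dual_mod X) X = ev D X.
Proof.
have [f [fE _]] := (rel_coeq (dual_mod X) X).2 _ _ (dual_actE X).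
by have [g gE] := cofree f; exists g; rewrite gE.
Qed.

Definition evT (X : lmodule A) : mod_hom (dual_mod X ⊗[T] X) (dual_mod A1) :=
  sval (constructive_indefinite_description _ (evT_ex X)).

Lemma evTE (X : lmodule A) :
  counit ∘ mod_hom_val (evT X) ∘ pi (dual_mod X) X = ev D X.
Proof. by rewrite /evT; case: constructive_indefinite_description. Qed.

Lemma evT_tensE (X Y Z : lmodule A) (g : mod_hom Y (dual_mod X))
    (f : mod_hom Z X) :
  counit ∘ mod_hom_val (mod_comp (evT X) (tensm T g f)) ∘ pi Y Z =
  ev D X ∘ (mod_hom_val g ⊠[M] mod_hom_val f).
Proof.
by rewrite mod_compE compmA (at2 (relative_tensm relT _ _)) compmA evTE.
Qed.

(** Composition with [counit] and with [pi] loses no information on morphisms to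
    [DA], and it turns the evaluation of [C_A] into that of [C]. *)
Lemma evT_transposeP (X Y : lmodule A) (g : mod_hom Y (dual_mod X))
    (f : mod_hom (Y ⊗[T] X) (dual_mod A1)) :
  mod_comp (evT X) (tensm T g (mod_idm X)) = f <->
  ev D X ∘ (mod_hom_val g ▹ X) = counit ∘ mod_hom_val f ∘ pi Y X.
Proof.
rewrite -(mod_idmE X) -evT_tensE; split=> [->//|e].
by apply/cofree_inj/rel_epi.
Qed.

Lemma evT_universal (X Y : lmodule A)
    (f : mod_hom (Y ⊗[T] X) (dual_mod A1)) :
  exists! g : mod_hom Y (dual_mod X),
    mod_comp (evT X) (tensm T g (mod_idm X)) = f.
Proof.
pose h := counit ∘ mod_hom_val f ∘ pi Y X.
have gP : transpose D h ∘ lact Y =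
    lact (dual_mod X) ∘ (acar A ◃ transpose D h).
  apply/dual_mod_homP; rewrite transposeP /A_balanced -!compmA.
  by rewrite (rel_coeq Y X).1.
exists (@mkmod_hom _ _ _ _ _ Y (dual_mod X) _ gP); split; first by apply/evT_transposeP/transposeP.
by move=> g' /evT_transposeP e; apply: mod_hom_inj; apply: transpose_uniq.
Qed.

Definition dual_data_mod : dual_data T (dual_mod A1) :=
  @DualData k (mod_cat A) (regular_mod A) T (dual_mod A1) dual_mod evT
    evT_universal.

Lemma dual_map_modE (X Y : lmodule A) (f : mod_hom X Y) :
  mod_hom_val (dual_map dual_data_mod f) = dual_map D (mod_hom_val f).
Proof.
apply/esym/transpose_uniq.
have /evT_transposeP -> := @transposeP _ _ _ _ _ dual_data_mod X (dual_mod Y)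
  (mod_comp (evT Y) (tensm T (mod_idm (dual_mod Y)) f)).
exact: evT_tensE.
Qed.

(** Only full faithfulness and essential surjectivity remain, and both are
    statements about underlying morphisms by [dual_map_modE]. *)
Lemma dual_mod_dualizing : is_dualizing T (dual_mod A1).
Proof.
constructor; exists dual_data_mod; apply: fully_faithful_equivalence.
  move=> Y X g; have [f fE] := dual_map_surj (mod_hom_val g).
  exists (@mkmod_hom _ _ _ _ _ X Y f (dual_map_mod_hom fE)); split.
    by apply: mod_hom_inj; rewrite dual_map_modE.
  move=> f' f'E; apply: mod_hom_inj; apply: (coev_inj (D := D)) => /=.
  rewrite -!dual_map_ev fE -dual_map_modE.
  by rewrite -[g]f'E.
move=> Y; have [X [t t_iso]] := dual_mod_surj Y.
by exists X, t; apply: mod_iso.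
Qed.

End Dualizing.
End DualModules.

Theorem theorem1p4 (k : fieldType) (C : lincat k) (abC : is_abelian C)
    (I : C) (M : monoidal I) (c : braiding M) (K : C) (D : dualizing M K)
    (A : algebra M) (commA : commutative_algebra c A) :
  is_abelian (mod_cat A) /\
  (exists T : monoidal (regular_mod A), relative_monoidal c T) /\
  exists mu : mor (A ⊗[M] dual_ob D A) (dual_ob D A),
    unique (fun nu => is_dual_action c nu) mu /\
    exists mu_action : is_action mu,
      forall T : monoidal (regular_mod A), relative_monoidal c T ->
        is_dualizing T (LModule mu_action).
Proof.
have coeql (X Y Q Z : C) (f g : mor X Y) (p : mor Y Q) :
    is_coequalizer f g p ->
    is_coequalizer (Z ◃[M] f) (Z ◃[M] g) (Z ◃[M] p).
  exact: (tensl_coequalizer c D).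
have coeqr (X Y Q Z : C) (f g : mor X Y) (p : mor Y Q) :
    is_coequalizer f g p ->
    is_coequalizer (f ▹[M] Z) (g ▹[M] Z) (p ▹[M] Z).
  exact: (tensr_coequalizer D).
split; first by apply: mod_cat_abelian abC _ => *; apply: coeql.
split.
  have /dependent_choice[tn /dependent_choice[pi piP]] :=
    fun p : lmodule A * lmodule A => tensor_over_ex commA coeql abC p.1 p.2.
  exists (tensor_over_monoidal commA coeql coeqr
    (fun X Y => (piP (X, Y)).1) (fun X Y => (piP (X, Y)).2)).
  exact: tensor_over_monoidalP.
exists (dual_act c D (regular_mod A)); split; first split.
- exact: dual_act_dual_action.
- exact: dual_action_uniq.
exists (dual_act_is_action D commA (regular_mod A)) => T [pi relT].
exact: dual_mod_dualizing relT.
Qed.
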